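(* Let $Q:\mathbb{R}\to\mathbb{R}^{2\times 2}$ be a real symmetric matrix valued function with absolutely continuous $\pi$-periodic entries. All instability intervals of the equation $JY'+QY=\lambda Y$ vanish if and only if $Q=pI$ for some absolutely continuous real (scalar) valued $\pi$-periodic function $p$, where $I$ is the $2\times 2$ identity matrix.
   Context: Here $J=\begin{pmatrix}0&1\\-1&0\end{pmatrix}$. Let $\mathbb{Y}(z,\lambda)$ be the $2\times 2$ matrix solution of $J\mathbb{Y}'+Q\mathbb{Y}=\lambda\mathbb{Y}$ (derivative with respect to $z$) with $\mathbb{Y}(0,\lambda)=I$. The discriminant is $\Delta(\lambda)=\operatorname{trace}\mathbb{Y}(\pi,\lambda)$; it is real for $\lambda\in\mathbb{R}$. The instability intervals are the connected components of $\{\lambda\in\mathbb{R}: |\Delta(\lambda)|>2\}$. ''All instability intervals vanish'' means that they are all empty, i.e. $|\Delta(\lambda)|\le 2$ for all $\lambda\in\mathbb{R}$. Absolutely continuous means absolutely continuous on every compact interval of $\mathbb{R}$. *)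

(* Defs.v *)
From HB Require Import structures.
From mathcomp Require Import all_boot all_order all_algebra.
From mathcomp Require Import all_classical all_reals all_analysis.
Import Order.TTheory GRing.Theory Num.Theory numFieldNormedType.Exports.
Set Implicit Arguments.
Unset Strict Implicit.
Unset Printing Implicit Defensive.
Local Open Scope classical_set_scope.
Local Open Scope ring_scope.

Definition abs_continuous_on (R : realType) (f : R -> R) (a b : R) : Prop :=
  forall e : R, 0 < e -> exists2 d : R, 0 < d &
    forall (n : nat) (u v : 'I_n -> R),
      (forall i, a <= u i /\ u i <= v i /\ v i <= b) ->
      trivIset setT (fun i => `]u i, v i[%classic) ->
      \sum_(i < n) (v i - u i) < d ->
      \sum_(i < n) `|f (v i) - f (u i)| < e.

Definition abs_continuous (R : realType) (f : R -> R) : Prop :=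
  forall a b : R, a <= b -> abs_continuous_on f a b.

(* The matrix with rows (0, 1) and (-1, 0). *)
Definition symplJ (R : realType) : 'M[R]_2 :=
  \matrix_(i, j) (if (i < j)%N then 1 else if (j < i)%N then -1 else 0).

(* For continuous [Q], as here, the solutions of [J Y' + Q Y = lam Y] are
   differentiable everywhere, so [Y] is required to be a classical solution. *)
Definition fundamental_solution (R : realType) (Q : R -> 'M[R]_2)
    (Y : R -> R -> 'M[R]_2) : Prop :=
  forall lam : R, Y 0 lam = 1%:M /\
    forall z : R, derivable (Y ^~ lam) z 1 /\
      symplJ R *m derive1 (Y ^~ lam) z + Q z *m Y z lam = lam *: Y z lam.

Definition discriminant (R : realType) (Y : R -> R -> 'M[R]_2) (lam : R) : R :=
  \tr (Y pi lam).

Definition instability_set (R : realType) (Y : R -> R -> 'M[R]_2) : set R :=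
  [set lam | 2 < `|discriminant Y lam|].

Definition instability_intervals (R : realType) (Y : R -> R -> 'M[R]_2) :
    set (set R) :=
  [set connected_component (instability_set Y) lam
     | lam in instability_set Y].

Definition all_instability_intervals_vanish (R : realType)
    (Y : R -> R -> 'M[R]_2) : Prop :=
  forall I : set R, instability_intervals Y I -> I = set0.

(* Main.v *)
(* Write [Y = (a, b; c, d)] at [z = pi], [f = (a + d) / 2] and [G = Y^T Y].
   Differentiating in [l] gives [2 f' = \int_0^pi tr (B G)] for a symmetric
   [B] depending only on [Y pi l], with [det B = 1 - f ^ 2].  As [det G = 1],
   AM-GM yields the Deift-Simon inequality [|f'| >= pi sqrt (1 - f ^ 2)] in the
   bands, with equality only if [G] is constant on ]0, pi[, which makes [J Q]
   skew there, so that [Q] is scalar.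

   Assume that all gaps are closed but [Q] is not scalar.  Where [f ^ 2 = 1],
   [f' = 0] forces [c = 0]; and [acos f] has slope of modulus greater than [pi]
   elsewhere, so every open interval of length 1 contains a zero of [c].  These
   zeros are the points [l_n] where the Pruefer angle [phi l] at [z = pi] of the
   first column equals [n pi]; hence [l_(n+1) - l_n < 1].  But
   [phi l - pi l] has the same limit as [l] tends to both infinities, and so has
   [l_n - n], which is strictly decreasing: a contradiction. *)
Require Import Defs.
From mathcomp Require Import all_boot all_order all_algebra.
From mathcomp Require Import all_classical all_reals all_analysis.
From mathcomp Require Import ring lra.
Import Order.TTheory GRing.Theory Num.Theory numFieldNormedType.Exports.
Set Implicit Arguments.
Unset Strict Implicit.
Unset Printing Implicit Defensive.
Local Open Scope classical_set_scope.
Local Open Scope ring_scope.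

(** * Derivative rules and their automation *)

Section Calculus.
Context {R : realType}.
Implicit Types (f g : R -> R) (x z df dg : R).

Lemma is_derive_fun_cst c z : is_derive z 1 (fun=> c : R) (0 : R).
Proof. exact: is_derive_cst. Qed.

Lemma is_derive_fun_id z : is_derive z 1 (fun x : R => x) (1 : R).
Proof. exact: is_derive_id. Qed.

Lemma is_derive_funD f g z df dg : is_derive z 1 f df -> is_derive z 1 g dg ->
  is_derive z 1 (fun x => f x + g x) (df + dg).
Proof. by move=> *; exact: is_deriveD. Qed.

Lemma is_derive_funN f z df : is_derive z 1 f df ->
  is_derive z 1 (fun x => - f x) (- df).
Proof. by move=> *; exact: is_deriveN. Qed.

Lemma is_derive_funM f g z df dg : is_derive z 1 f df -> is_derive z 1 g dg ->
  is_derive z 1 (fun x => f x * g x) (df * g z + f z * dg).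
Proof.
move=> Hf Hg; have H := is_deriveM Hf Hg; apply: (is_derive_eq H).
by rewrite /GRing.scale /=; ring.
Qed.

Lemma is_derive_fun_sin f z df : is_derive z 1 f df ->
  is_derive z 1 (fun x => sin (f x)) (cos (f z) * df).
Proof.
by move=> Hf; exact: (is_derive1_comp (is_derive_sin (f z)) Hf).
Qed.

Lemma is_derive_fun_cos f z df : is_derive z 1 f df ->
  is_derive z 1 (fun x => cos (f x)) (- sin (f z) * df).
Proof.
by move=> Hf; exact: (is_derive1_comp (is_derive_cos (f z)) Hf).
Qed.

Lemma is_derive_fun_expR f z df : is_derive z 1 f df ->
  is_derive z 1 (fun x => expR (f x)) (expR (f z) * df).
Proof.
by move=> Hf; exact: (is_derive1_comp (is_derive_expR (f z)) Hf).
Qed.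

Lemma is_derive_continuous f z df : is_derive z 1 f df -> {for z, continuous f}.
Proof. by move=> [fz _]; apply/differentiable_continuous/derivable1_diffP. Qed.

End Calculus.

(** The rules above are stated on explicit abstractions, so that unification on the syntax of the
    function synthesizes a derivative; [derive_as] leaves its equality with the expected one to a
    tactic. *)
Ltac derive_fun :=
  repeat (first [ eassumption | eapply is_derive_fun_cst | eapply is_derive_fun_id
   | eapply is_derive_funD | eapply is_derive_funN | eapply is_derive_funM
   | eapply is_derive_fun_sin | eapply is_derive_fun_cos | eapply is_derive_fun_expR ]).
Ltac derive_as tac := eapply is_derive_eq; [derive_fun | cbv beta; tac].

(** * Mean value inequalities, Gronwall's lemma and primitives *)

Section MeanValue.
Context {R : realType}.
Implicit Types (f g df : R -> R) (a b x z K : R).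

Lemma mean_value f df a b : a < b ->
  (forall x, a < x < b -> is_derive x 1 f (df x)) ->
  (forall x, a <= x <= b -> {for x, continuous f}) ->
  exists2 c, a < c < b & f b - f a = df c * (b - a).
Proof.
move=> ab Df Cf.
have Df' x : x \in `]a, b[ -> is_derive x 1 f (df x).
  by rewrite in_itv /=; exact: Df.
have Cf' : {within `[a, b], continuous f}.
  by apply/continuous_in_subspaceT => x; rewrite inE /= in_itv /=; exact: Cf.
by have [c] := MVT ab Df' Cf'; rewrite in_itv /= => ? ?; exists c.
Qed.

Lemma mean_value_closed f df a b : a < b ->
  (forall x, a <= x <= b -> is_derive x 1 f (df x)) ->
  exists2 c, a < c < b & f b - f a = df c * (b - a).
Proof.
move=> ab Df; apply: mean_value => // x xab.
  by apply: Df; case/andP: xab => /ltW -> /ltW ->.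
exact: is_derive_continuous (Df x xab).
Qed.

Lemma derive_ge0_le f df a b : a <= b ->
  (forall x, a <= x <= b -> is_derive x 1 f (df x)) ->
  (forall x, a < x < b -> 0 <= df x) -> f a <= f b.
Proof.
rewrite le_eqVlt => /predU1P[-> //|ab] Df df0.
have [c cab E] := mean_value_closed ab Df.
by rewrite -subr_ge0 E mulr_ge0 ?df0// subr_ge0 ltW.
Qed.

Lemma derive_gt0_lt f df a b : a < b ->
  (forall x, a <= x <= b -> is_derive x 1 f (df x)) ->
  (forall x, a < x < b -> 0 < df x) -> f a < f b.
Proof.
move=> ab Df df0.
have [c cab E] := mean_value_closed ab Df.
by rewrite -subr_gt0 E mulr_gt0 ?df0// subr_gt0.
Qed.

Lemma derive_bounded_lip f df K a b : a <= b ->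
  (forall x, a <= x <= b -> is_derive x 1 f (df x)) ->
  (forall x, a < x < b -> `|df x| <= K) -> `|f b - f a| <= K * (b - a).
Proof.
rewrite le_eqVlt => /predU1P[->|ab] Df dfK; first by rewrite !subrr normr0 mulr0.
have [c cab E] := mean_value_closed ab Df.
by rewrite E normrM ler_pM ?dfK// ger0_norm// subr_ge0 ltW.
Qed.

Lemma derive_eq0_const f a b : a <= b ->
  (forall x, a <= x <= b -> is_derive x 1 f 0) -> f b = f a.
Proof.
move=> ab Df; apply/eqP; rewrite -subr_eq0 -normr_eq0 eq_le normr_ge0 andbT.
by rewrite -(mul0r (b - a)); apply: derive_bounded_lip Df _ => //; rewrite normr0.
Qed.

(** The product of [f x] with [expR (- (K * (x - a)))] is nonincreasing. *)
Lemma gronwall f df K a b : a <= b ->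
  (forall x, a <= x <= b -> is_derive x 1 f (df x)) ->
  (forall x, a < x < b -> df x <= K * f x) ->
  f b <= f a * expR (K * (b - a)).
Proof.
move=> ab Df dfK.
have : - (f a * expR (- (K * (a - a)))) <= - (f b * expR (- (K * (b - a)))).
  apply: (@derive_ge0_le (fun x => - (f x * expR (- (K * (x - a)))))
    (fun x => (K * f x - df x) * expR (- (K * (x - a))))) => // x xab.
    have := Df x xab => Dfx.
    by derive_as ltac:(ring).
  by rewrite mulr_ge0 ?expR_ge0// subr_ge0 dfK.
rewrite lerN2 subrr mulr0 oppr0 expR0 mulr1 expRN.
by rewrite ler_pdivrMr ?expR_gt0.
Qed.

Lemma primitive_exists g : continuous g ->
  exists2 G : R -> R, G 0 = 0 & forall z, 0 <= z -> is_derive z 1 G (g z).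
Proof.
move=> cg.
(* Starting the integral at [-1] makes [0] an interior point, so that the derivative there is
   two-sided. *)
pose F x := (\int[lebesgue_measure]_(t in [set` `[(-1 : R), x]]) (g t))%R.
exists (fun x => F x - F 0) => [|z z0]; first by rewrite subrr.
have zz1 : z < z + 1 by rewrite ltrDl.
have ig : lebesgue_measure.-integrable `[(-1 : R), z + 1] (EFin \o g).
  apply: continuous_compact_integrable; first exact: segment_compact.
  exact: continuous_subspaceT.
have Nz : -1 < z by apply: lt_le_trans z0; rewrite ltrN10.
have [dF F'] := continuous_FTC1_closed zz1 ig Nz (cg z).
have DF : is_derive z 1 F (g z) by split; [exact: dF|rewrite -derive1E; exact: F'].
by derive_as ltac:(ring).
Qed.

End MeanValue.

(** * Local constancy, and derivatives from a quadratic remainder *)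

Section MoreCalculus.
Context {R : realType}.
Implicit Types (f g : R -> R) (a b x z l K : R).

Lemma derive_locally_const f a b z k l : a < z < b ->
  (forall x, a < x < b -> f x = k) -> is_derive z 1 f l -> l = 0.
Proof.
move=> zab fk Df.
suff Dk : is_derive z 1 f 0 by rewrite -(@derive_val _ _ _ _ _ _ _ Df) derive_val.
have fn : \near z, k = f z.
  have : z \in `]a, b[ by rewrite in_itv.
  by move/near_in_itvoo; apply: filterS => x; rewrite in_itv /= => /fk ->.
exact: near_eq_is_derive fn (is_derive_fun_cst k z).
Qed.

(** This is how differentiability in the spectral parameter is obtained: [fundamental_solution]
    assumes no regularity in [lam], but a perturbation estimate yields such a remainder. *)
Lemma is_derive_quadratic_remainder f z l K :
  (forall x, `|f x - f z - (x - z) * l| <= K * (x - z) ^+ 2) ->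
  is_derive z 1 f l.
Proof.
move=> fK.
have K0 : 0 <= K.
  have := fK (z + 1); rewrite (addrC z) addrK expr1n mulr1; exact: le_trans.
have cf : (fun h => h^-1 *: ((f \o shift z) (h *: (1 : R)) - f z)) @ 0^' --> l.
  apply/cvgrPdist_le => e e0.
  near=> h.
  have h0 : h != 0 by near: h; exact: nbhs_dnbhs_neq.
  rewrite /= /GRing.scale /= mulr1.
  have := fK (h + z); rewrite addrK => H.
  have -> : l - h^-1 * (f (h + z) - f z) = - (h^-1 * (f (h + z) - f z - h * l)).
    by field.
  rewrite normrN normrM normfV ler_pdivrMl ?normr_gt0//.
  apply: (le_trans H); rewrite -[h ^+ 2]real_normK ?num_real// expr2 mulrA [leRHS]mulrC ler_wpM2r//.
  (* [K] may be [0], hence the denominator [K + 1]. *)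
  have : `|h| <= e / (K + 1).
    near: h; apply: dnbhs0_le; apply: divr_gt0 => //; exact: ltr_wpDl.
  rewrite ler_pdivlMr ?ltr_wpDl// => He.
  by apply: le_trans He; rewrite mulrC ler_wpM2l// lerDl.
split; first by apply/cvg_ex; exists l.
exact/cvg_lim.
Unshelve. all: by end_near. Qed.

End MoreCalculus.

(** * One column of the system, solved for the derivatives, and its perturbation in the spectral
    parameter *)

Definition dirac_solution {R : realType} (q11 q12 q22 : R -> R) (l : R)
    (x y : R -> R) : Prop :=
  forall z : R, is_derive z 1 x (q12 z * x z + (q22 z - l) * y z) /\
    is_derive z 1 y (- ((q11 z - l) * x z + q12 z * y z)).

Section Dirac.
Context {R : realType} (q11 q12 q22 : R -> R).
Implicit Types (a b c d x y s : R -> R) (z l m L K : R).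
Local Notation sol := (dirac_solution q11 q12 q22).

(** Liouville's formula: the coefficient matrix of the first-order system has trace zero. *)
Lemma dirac_wronskian l a b c d : sol l a c -> sol l b d -> forall z,
  a z * d z - b z * c z = a 0 * d 0 - b 0 * c 0.
Proof.
move=> ac bd z; pose W (z : R) := a z * d z - b z * c z.
have DW (t : R) : is_derive t 1 W 0.
  have [Da Dc] := ac t; have [Db Dd] := bd t.
  by derive_as ltac:(ring).
have [z0|/ltW z0] := leP 0 z; first exact: (derive_eq0_const z0 (fun t _ => DW t)).
exact/esym/(derive_eq0_const z0 (fun t _ => DW t)).
Qed.

(** The form is the derivative of [x ^+ 2 + y ^+ 2] along a solution, and also that of
    [angular_form] in the angle. Both differences to the bounds are combinations of squares with
    nonnegative weights. *)
Lemma quadratic_form_bound (p q r u v : R) K :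
  `|p| <= K -> `|q| <= K -> `|r| <= K ->
  `|2 * q * (u ^+ 2 - v ^+ 2) + 2 * (r - p) * (u * v)| <= 4 * K * (u ^+ 2 + v ^+ 2).
Proof.
rewrite !ler_norml => /andP[h1 h2] /andP[h3 h4] /andP[h5 h6].
set S := 2 * q * _ + _; set T := 4 * K * _.
have TB : T - S = 2 * (K - q) * u ^+ 2 + 2 * (K + q) * v ^+ 2 +
    ((K + (r - p) / 2) * (u - v) ^+ 2 + (K - (r - p) / 2) * (u + v) ^+ 2).
  by rewrite /T /S; field.
have TD : S - - T = 2 * (K + q) * u ^+ 2 + 2 * (K - q) * v ^+ 2 +
    ((K - (r - p) / 2) * (u - v) ^+ 2 + (K + (r - p) / 2) * (u + v) ^+ 2).
  by rewrite /T /S; field.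
by apply/andP; split; rewrite -subr_ge0 ?TB ?TD !addr_ge0// mulr_ge0 ?sqr_ge0//; lra.
Qed.

(** The parameter [l] cancels in the derivative of [x ^+ 2 + y ^+ 2], so Gronwall's lemma gives a
    bound uniform in [l]. *)
Lemma dirac_solution_norm l x y K z :
  (forall z, 0 <= z <= pi -> [/\ `|q11 z| <= K, `|q12 z| <= K & `|q22 z| <= K]) ->
  sol l x y -> 0 <= z <= pi ->
  x z ^+ 2 + y z ^+ 2 <= (x 0 ^+ 2 + y 0 ^+ 2) * expR (4 * K * pi).
Proof.
move=> qK xy /andP[z0 zpi].
have K0 : 0 <= K.
  have [|+ _ _] := qK 0; first by rewrite lexx pi_ge0.
  exact: le_trans.
apply: (@le_trans _ _ ((x 0 ^+ 2 + y 0 ^+ 2) * expR (4 * K * (z - 0)))); last first.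
  rewrite ler_wpM2l ?addr_ge0 ?sqr_ge0// ler_expR ler_wpM2l ?subr0//.
  by rewrite mulr_ge0.
apply: (@gronwall _ (fun z => x z ^+ 2 + y z ^+ 2) (fun z =>
  2 * q12 z * (x z ^+ 2 - y z ^+ 2) + 2 * (q22 z - q11 z) * (x z * y z))) => //.
  move=> t _; have [Dx Dy] := xy t.
  rewrite (_ : (fun _ => _) = fun z => x z * x z + y z * y z); last first.
    by apply/funext => ?; rewrite !expr2.
  by derive_as ltac:(ring).
move=> t /andP[/ltW t0 /ltW tz].
have [|q1 q2 q3] := qK t; first by rewrite t0 (le_trans tz).
exact: le_trans (ler_norm _) (quadratic_form_bound _ _ q1 q2 q3).
Qed.

(* Variation of constants: in the frame [(a, b; c, d)] of parameter [l], a
   solution of parameter [m] has coordinates [(u1, u2)] with derivatives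
   [-(m - l)(b x + d y)] and [(m - l)(a x + c y)]. *)
Lemma dirac_perturbation l m a b c d x y s11 s12 s22 L :
  sol l a c -> sol l b d -> a 0 = 1 -> c 0 = 0 -> b 0 = 0 -> d 0 = 1 ->
  sol m x y ->
  (forall z, 0 <= z <= pi -> [/\ `|a z| <= L, `|b z| <= L, `|c z| <= L
     & `|d z| <= L] /\ `|x z| <= L /\ `|y z| <= L) ->
  s11 0 = 0 -> s12 0 = 0 -> s22 0 = 0 ->
  (forall z, 0 <= z -> [/\ is_derive z 1 s11 (a z ^+ 2 + c z ^+ 2),
    is_derive z 1 s12 (a z * b z + c z * d z)
    & is_derive z 1 s22 (b z ^+ 2 + d z ^+ 2)]) ->
  exists r1 r2, [/\ `|r1| <= 8 * L ^+ 4 * pi ^+ 2 * (m - l) ^+ 2,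
    `|r2| <= 8 * L ^+ 4 * pi ^+ 2 * (m - l) ^+ 2,
    x pi = a pi * (x 0 - (m - l) * (s12 pi * x 0 + s22 pi * y 0) + r1) +
      b pi * (y 0 + (m - l) * (s11 pi * x 0 + s12 pi * y 0) + r2) &
    y pi = c pi * (x 0 - (m - l) * (s12 pi * x 0 + s22 pi * y 0) + r1) +
      d pi * (y 0 + (m - l) * (s11 pi * x 0 + s12 pi * y 0) + r2)].
Proof.
move=> ac bd a0 c0 b0 d0 xy bL s110 s120 s220 Ds.
have det z : 0 <= z -> a z * d z - b z * c z = 1.
  by move=> z0; rewrite (dirac_wronskian ac bd)// a0 b0 c0 d0; ring.
(* Coordinates in the frame, found by inverting a matrix of determinant [1], minus their initial
   values; both are [O(m - l)]. *)
pose u1 z := d z * x z - b z * y z - x 0; pose u2 z := a z * y z - c z * x z - y 0.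
have L0 : 0 <= L.
  have [|[+ _ _ _] _] := bL 0; first by rewrite lexx pi_ge0.
  exact: le_trans.
have Du1 z : is_derive z 1 u1 (- (m - l) * (b z * x z + d z * y z)).
  have [Da Dc] := ac z; have [Db Dd] := bd z; have [Dx Dy] := xy z.
  by derive_as ltac:(ring).
have Du2 z : is_derive z 1 u2 ((m - l) * (a z * x z + c z * y z)).
  have [Da Dc] := ac z; have [Db Dd] := bd z; have [Dx Dy] := xy z.
  by derive_as ltac:(ring).
have u10 : u1 0 = 0 by rewrite /u1 b0 d0; ring.
have u20 : u2 0 = 0 by rewrite /u2 a0 c0; ring.
have bilin (p q r t : R) M : `|p| <= L -> `|q| <= L -> `|r| <= M -> `|t| <= M ->
    `|p * r + q * t| <= 2 * L * M.
  move=> ? ? ? ?; apply: le_trans (ler_normD _ _) _; rewrite !normrM.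
  have -> : 2 * L * M = L * M + L * M by ring.
  by apply: lerD; apply: ler_pM.
have lip z (f df : R -> R) M : 0 <= z <= pi -> f 0 = 0 -> 0 <= M ->
    (forall t : R, 0 <= t <= z -> is_derive t 1 f (df t)) ->
    (forall t : R, 0 <= t <= pi -> `|df t| <= M) -> `|f z| <= M * pi.
  move=> /andP[z0 zpi] f0 M0 Df dfM.
  have H : `|f z - f 0| <= M * (z - 0).
    apply: (derive_bounded_lip z0 Df) => t /andP[/ltW t0 /ltW tz].
    by apply: dfM; rewrite t0 (le_trans tz).
  by move: H; rewrite f0 !subr0 => /le_trans; apply; rewrite ler_wpM2l.
pose C1 : R := `|m - l| * (2 * L * L) * pi.
have C10 : 0 <= C1 by rewrite !mulr_ge0 ?pi_ge0.
have u1C z : 0 <= z <= pi -> `|u1 z| <= C1.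
  move=> zpi; apply: (lip _ _ _ _ zpi u10 _ (fun z _ => Du1 z)).
    by rewrite !mulr_ge0.
  move=> t tpi; have [[? ? ? ?] [? ?]] := bL t tpi.
  by rewrite normrM normrN ler_wpM2l// bilin.
have u2C z : 0 <= z <= pi -> `|u2 z| <= C1.
  move=> zpi; apply: (lip _ _ _ _ zpi u20 _ (fun z _ => Du2 z)).
    by rewrite !mulr_ge0.
  move=> t tpi; have [[? ? ? ?] [? ?]] := bL t tpi.
  by rewrite normrM ler_wpM2l// bilin.
have xE z : 0 <= z -> x z = a z * (x 0 + u1 z) + b z * (y 0 + u2 z).
  by move=> /det; rewrite /u1 /u2 => D; rewrite -[LHS]mulr1 -D; ring.
have yE z : 0 <= z -> y z = c z * (x 0 + u1 z) + d z * (y 0 + u2 z).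
  by move=> /det; rewrite /u1 /u2 => D; rewrite -[LHS]mulr1 -D; ring.
(* Once the first-order terms are removed, the derivatives are [m - l] times linear forms in
   [(u1, u2)], which is itself [O(m - l)]; hence the quadratic remainders. *)
pose v1 z := u1 z + (m - l) * (s12 z * x 0 + s22 z * y 0).
pose v2 z := u2 z - (m - l) * (s11 z * x 0 + s12 z * y 0).
have piI : 0 <= (pi : R) <= pi by rewrite lexx pi_ge0.
have CE : (`|m - l| * (2 * L * (2 * L * C1)) * pi : R) = 8 * L ^+ 4 * pi ^+ 2 * (m - l) ^+ 2.
  by rewrite -[(m - l) ^+ 2]real_normK ?num_real// /C1; ring.
have M0 : 0 <= `|m - l| * (2 * L * (2 * L * C1)).
  by rewrite !mulr_ge0// ?pi_ge0.
have Dv1 z : 0 <= z <= pi -> is_derive z 1 v1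
    (- (m - l) * (b z * (a z * u1 z + b z * u2 z) + d z * (c z * u1 z + d z * u2 z))).
  move=> /andP[z0 _]; have [D11 D12 D22] := Ds z z0; have D1 := Du1 z.
  derive_as idtac.
  by rewrite (xE z z0) (yE z z0); ring.
have Dv2 z : 0 <= z <= pi -> is_derive z 1 v2
    ((m - l) * (a z * (a z * u1 z + b z * u2 z) + c z * (c z * u1 z + d z * u2 z))).
  move=> /andP[z0 _]; have [D11 D12 D22] := Ds z z0; have D2 := Du2 z.
  derive_as idtac.
  by rewrite (xE z z0) (yE z z0); ring.
exists (v1 pi), (v2 pi); split.
- rewrite -CE; apply: (lip _ _ _ _ piI _ M0 Dv1).
    by rewrite /v1 u10 s120 s220; ring.
  move=> t tpi; have [[? ? ? ?] [? ?]] := bL t tpi.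
  by rewrite normrM normrN ler_wpM2l// bilin// bilin// ?u1C ?u2C.
- rewrite -CE; apply: (lip _ _ _ _ piI _ M0 Dv2).
    by rewrite /v2 u20 s110 s120; ring.
  move=> t tpi; have [[? ? ? ?] [? ?]] := bL t tpi.
  by rewrite normrM ler_wpM2l// bilin// bilin// ?u1C ?u2C.
- by rewrite xE ?pi_ge0// /v1 /v2; ring.
- by rewrite yE ?pi_ge0// /v1 /v2; ring.
Qed.

End Dirac.

(** * Derivative of the trace and its strict lower bound *)

Section Trace.
Context {R : realType} (q11 q12 q22 : R -> R).
Implicit Types (a b c d x y s : R -> R) (z l m L K : R).
Local Notation sol := (dirac_solution q11 q12 q22).

Lemma dirac_solution_bound K :
  (forall z, 0 <= z <= pi -> [/\ `|q11 z| <= K, `|q12 z| <= K & `|q22 z| <= K]) ->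
  exists L, forall l x y, sol l x y -> x 0 ^+ 2 + y 0 ^+ 2 = 1 ->
    forall z, 0 <= z <= pi -> `|x z| <= L /\ `|y z| <= L.
Proof.
(* With [E] the exponential, [1 + E] bounds the modulus of any [t] with [t ^+ 2 <= E] without a
   square root. *)
move=> qK; exists (1 + expR (4 * K * pi)) => l x y xy xy0 z zpi.
have := dirac_solution_norm qK xy zpi; rewrite xy0 mul1r.
set E := expR _ => H.
have le_sqr (t u : R) : t ^+ 2 + u ^+ 2 <= E -> `|t| <= 1 + E.
  move=> tuE; have u2 := sqr_ge0 u; have t1 := sqr_ge0 (t + 1).
  have t2 := sqr_ge0 (t - 1); have t3 := sqr_ge0 t.
  by rewrite ler_norml; apply/andP; split; nra.
by split; [exact: le_sqr H|apply: le_sqr (x z) _; rewrite addrC].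
Qed.

(** With [S] the integral of [G = Y^T Y] over [[0, pi]], the value is [tr (B S)] for
    [B = (b, (d - a) / 2; (d - a) / 2, - c)]. The perturbation expansion is applied to both columns;
    the four remainders enter with coefficients bounded by [L]. *)
Lemma trace_is_derive K (a b c d : R -> R -> R) l s11 s12 s22 :
  (forall z, 0 <= z <= pi -> [/\ `|q11 z| <= K, `|q12 z| <= K & `|q22 z| <= K]) ->
  (forall m, [/\ sol m (a m) (c m), sol m (b m) (d m),
    a m 0 = 1 /\ c m 0 = 0 & b m 0 = 0 /\ d m 0 = 1]) ->
  s11 0 = 0 -> s12 0 = 0 -> s22 0 = 0 ->
  (forall z, 0 <= z -> [/\ is_derive z 1 s11 (a l z ^+ 2 + c l z ^+ 2),
    is_derive z 1 s12 (a l z * b l z + c l z * d l z)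
    & is_derive z 1 s22 (b l z ^+ 2 + d l z ^+ 2)]) ->
  is_derive l 1 (fun m => a m pi + d m pi)
    (b l pi * s11 pi + (d l pi - a l pi) * s12 pi - c l pi * s22 pi).
Proof.
move=> qK fund s110 s120 s220 Ds.
have [L solL] := dirac_solution_bound qK.
have bnd m z : 0 <= z <= pi ->
    [/\ `|a m z| <= L, `|b m z| <= L, `|c m z| <= L & `|d m z| <= L].
  move=> zpi; have [ac bd [a0 c0] [b0 d0]] := fund m.
  have [||? ?] := solL m _ _ ac _ z => //; first by rewrite a0 c0; ring.
  by have [||? ?] := solL m _ _ bd _ z => //; first by rewrite b0 d0; ring.
have [ac bd [a0 c0] [b0 d0]] := fund l.
have piI : 0 <= (pi : R) <= pi by rewrite lexx pi_ge0.
apply: (@is_derive_quadratic_remainder _ _ _ _ (4 * L * (8 * L ^+ 4 * pi ^+ 2))) => m.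
have [ac' bd' [a0' c0'] [b0' d0']] := fund m.
have B1 z : 0 <= z <= pi -> [/\ `|a l z| <= L, `|b l z| <= L, `|c l z| <= L &
    `|d l z| <= L] /\ `|a m z| <= L /\ `|c m z| <= L.
  by move=> zpi; have [] := bnd m z zpi; have := bnd l z zpi.
have B2 z : 0 <= z <= pi -> [/\ `|a l z| <= L, `|b l z| <= L, `|c l z| <= L &
    `|d l z| <= L] /\ `|b m z| <= L /\ `|d m z| <= L.
  by move=> zpi; have [] := bnd m z zpi; have := bnd l z zpi.
have [r1 [r2 [r1E r2E aE _]]] :=
  dirac_perturbation ac bd a0 c0 b0 d0 ac' B1 s110 s120 s220 Ds.
have [t1 [t2 [t1E t2E _ dE]]] :=
  dirac_perturbation ac bd a0 c0 b0 d0 bd' B2 s110 s120 s220 Ds.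
rewrite aE dE a0' c0' b0' d0'.
have -> : forall (a1 b1 c1 d1 S11 S12 S22 e : R),
  a1 * (1 - e * (S12 * 1 + S22 * 0) + r1) + b1 * (0 + e * (S11 * 1 + S12 * 0) + r2) +
  (c1 * (0 - e * (S12 * 0 + S22 * 1) + t1) + d1 * (1 + e * (S11 * 0 + S12 * 1) + t2)) -
  (a1 + d1) - e * (b1 * S11 + (d1 - a1) * S12 - c1 * S22) =
  a1 * r1 + b1 * r2 + (c1 * t1 + d1 * t2) by move=> *; ring.
have [aL bL cL dL] := bnd l pi piI.
set C := 8 * _ * _ in r1E r2E t1E t2E *.
have -> : 4 * L * C * (m - l) ^+ 2 = L * (C * (m - l) ^+ 2) + L * (C * (m - l) ^+ 2) +
  (L * (C * (m - l) ^+ 2) + L * (C * (m - l) ^+ 2)) by ring.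
apply: le_trans (ler_normD _ _) _; apply: lerD; apply: le_trans (ler_normD _ _) _;
  by apply: lerD; rewrite normrM; apply: ler_pM.
Qed.

(* With [B = (b, e; e, c)] and [G = (g, h; h, k)], [det G = 1] and
   [det B = s ^ 2], this is [tr (B G) >= 2 sqrt (det B det G)]. *)
Lemma trace_mul_ge_det (b e c g h k s : R) : 0 < b -> 0 < g -> 0 < s ->
  b * c - e ^+ 2 = s ^+ 2 -> g * k - h ^+ 2 = 1 ->
  2 * s <= b * g + 2 * e * h + c * k /\
  (b * g + 2 * e * h + c * k = 2 * s -> h = - e / s /\ g = (s + e ^+ 2 / s) / b).
Proof.
move=> b0 g0 s0 detB detG.
(* Multiplying by [b * g > 0] exhibits the defect as a sum of two squares, whose vanishing is the
   equality case. *)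
have E : b * g * (b * g + 2 * e * h + c * k - 2 * s) =
    (b * g + e * h - s) ^+ 2 + (s * h + e) ^+ 2.
  have -> : b * g * (b * g + 2 * e * h + c * k - 2 * s) =
    (b * g) ^+ 2 + 2 * e * h * (b * g) + (b * c) * (g * k) - 2 * s * (b * g) by ring.
  have -> : b * c = s ^+ 2 + e ^+ 2 by rewrite -detB; ring.
  have -> : g * k = 1 + h ^+ 2 by rewrite -detG; ring.
  by ring.
have bg : 0 < b * g by rewrite mulr_gt0.
split; first by rewrite -subr_ge0 -(pmulr_rge0 _ bg) E addr_ge0 ?sqr_ge0.
move=> T; move: E; rewrite T subrr mulr0 => /esym/eqP.
rewrite paddr_eq0 ?sqr_ge0// !sqrf_eq0 => /andP[/eqP E1 /eqP E2].
have hE : h = - e / s.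
  have -> : e = - (s * h) by apply/eqP; rewrite -addr_eq0 addrC E2.
  by rewrite opprK mulrAC divff ?mul1r// gt_eqF.
split=> //; apply: (mulfI (lt0r_neq0 b0)).
have -> : b * g = s - e * h by apply/eqP; rewrite -subr_eq0 -[X in _ == X]E1; apply/eqP; ring.
rewrite hE; field.
by rewrite !gt_eqF.
Qed.

(** The pointwise inequality [trace_mul_ge_det] is integrated over [[0, pi]]. If the result were not
    strict, equality would hold at each point of []0, pi[], and [g] and [h] would be constant
    there. *)
Lemma trace_integral_gt l a b c d s11 s12 s22 (b0 e0 c0 s : R) :
  sol l a c -> sol l b d -> a 0 = 1 -> c 0 = 0 -> b 0 = 0 -> d 0 = 1 ->
  s11 0 = 0 -> s12 0 = 0 -> s22 0 = 0 ->
  (forall z, 0 <= z -> [/\ is_derive z 1 s11 (a z ^+ 2 + c z ^+ 2),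
    is_derive z 1 s12 (a z * b z + c z * d z)
    & is_derive z 1 s22 (b z ^+ 2 + d z ^+ 2)]) ->
  0 < b0 -> 0 < s -> b0 * c0 - e0 ^+ 2 = s ^+ 2 ->
  ~ (forall z, 0 < z < pi -> q12 z = 0 /\ q11 z = q22 z) ->
  2 * pi * s < b0 * s11 pi + 2 * e0 * s12 pi + c0 * s22 pi.
Proof.
move=> ac bd a0 c00 b00 d0 s110 s120 s220 Ds b0p sp detB nq.
rewrite ltNge; apply/negP => H; apply: nq => z /andP[z0 zpi].
have det (x : R) : 0 <= x -> a x * d x - b x * c x = 1.
  by move=> x0; rewrite (dirac_wronskian ac bd)// a0 b00 c00 d0; ring.
pose g (x : R) : R := a x ^+ 2 + c x ^+ 2; pose h (x : R) : R := a x * b x + c x * d x.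
pose k (x : R) : R := b x ^+ 2 + d x ^+ 2.
have detG (x : R) : 0 <= x -> g x * k x - h x ^+ 2 = 1.
  move=> /det D; rewrite -(expr1n _ 2) -D /g /h /k; ring.
have g0 (x : R) : 0 <= x -> 0 < g x.
  move=> x0; rewrite lt_neqAle addr_ge0 ?sqr_ge0// andbT eq_sym.
  rewrite paddr_eq0 ?sqr_ge0// !sqrf_eq0; apply/negP => /andP[/eqP ax /eqP cx].
  by have := det _ x0; rewrite ax cx mul0r mulr0 subrr => /esym/eqP; rewrite oner_eq0.
pose F (x : R) : R := b0 * s11 x + 2 * e0 * s12 x + c0 * s22 x - 2 * s * x.
pose dF (x : R) : R := b0 * g x + 2 * e0 * h x + c0 * k x - 2 * s.
have DF (x : R) : 0 <= x -> is_derive x 1 F (dF x).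
  by move=> x0; have [D1 D2 D3] := Ds x x0; derive_as ltac:(rewrite /dF /g /h /k; ring).
have dF0 (x : R) : 0 <= x -> 0 <= dF x.
  move=> x0; rewrite subr_ge0.
  exact: (trace_mul_ge_det b0p (g0 x x0) sp detB (detG x x0)).1.
have F_mono (x y : R) : 0 <= x -> x <= y -> F x <= F y.
  move=> x0 xy; apply: (derive_ge0_le xy (df := dF)) => t /andP[xt _].
    exact: DF (le_trans x0 xt).
  exact: dF0 (le_trans x0 (ltW xt)).
(* [F] is nondecreasing with [F 0 = 0], and the negated conclusion says [F pi <= 0]. *)
have F0 (x : R) : 0 < x < pi -> F x = 0.
  move=> /andP[x0 xpi]; apply/eqP; rewrite eq_le; apply/andP; split.
    apply: (le_trans (F_mono _ _ (ltW x0) (ltW xpi))).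
    by rewrite /F subr_le0 (le_trans H)// mulrAC.
  have F00 : F 0 = 0 by rewrite /F s110 s120 s220; ring.
  by rewrite -F00 F_mono// ltW.
have gh (x : R) : 0 < x < pi -> h x = - e0 / s /\ g x = (s + e0 ^+ 2 / s) / b0.
  move=> xpi; have x0 : 0 <= x by case/andP: xpi => /ltW.
  have [_] := trace_mul_ge_det b0p (g0 x x0) sp detB (detG x x0); apply.
  apply/eqP; rewrite -subr_eq0; apply/eqP.
  exact: (derive_locally_const xpi F0 (DF x x0)).
have zI : 0 < z < pi by rewrite z0.
have [Da Dc] := ac z; have [Db Dd] := bd z.
pose w : R := q22 z - q11 z.
have Dg : is_derive z 1 (fun x : R => a x * a x + c x * c x)
   (2 * q12 z * (a z ^+ 2 - c z ^+ 2) + 2 * w * (a z * c z)).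
  by derive_as ltac:(rewrite /w; ring).
have Dh : is_derive z 1 h
   (2 * q12 z * (a z * b z - c z * d z) + w * (a z * d z + b z * c z)).
  by derive_as ltac:(rewrite /w; ring).
have E1 := derive_locally_const zI (fun (x : R) xI => (gh x xI).1) Dh.
have E2 : 2 * q12 z * (a z ^+ 2 - c z ^+ 2) + 2 * w * (a z * c z) = 0.
  apply: (derive_locally_const (k := (s + e0 ^+ 2 / s) / b0) zI _ Dg) => x xI.
  by have [_ <-] := gh x xI; rewrite /g; ring.
have gz := lt0r_neq0 (g0 z (ltW z0)).
have D := det z (ltW z0).
(* The vanishing of the derivatives of [g] and [h] is a linear system in [q12 z] and [w], of
   determinant [2 * g z] up to sign because [a d - b c = 1]. It is solved by Cramer's rule. *)
have X0 : 2 * g z * q12 z = 0.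
  transitivity ((2 * q12 z * (a z ^+ 2 - c z ^+ 2) + 2 * w * (a z * c z)) * (a z * d z + b z * c z)
   - 2 * (a z * c z) * (2 * q12 z * (a z * b z - c z * d z)
     + w * (a z * d z + b z * c z))); last first.
    by rewrite E1 E2; ring.
  by rewrite -[LHS]mulr1 -[X in _ * X]D /g; ring.
have q120 : q12 z = 0.
  by apply/eqP; move/eqP: X0; rewrite !mulf_eq0 pnatr_eq0 (negPf gz).
have W0 : g z * w = 0.
  move: E1 E2; rewrite q120 !(mulr0, mul0r, add0r) => E1 E2.
  transitivity (w * (a z * d z + b z * c z) * (a z ^+ 2 - c z ^+ 2)
    - 2 * w * (a z * c z) * (a z * b z - c z * d z)); last first.
    by rewrite E1 E2; ring.
  by rewrite -[LHS]mulr1 -[X in _ * X]D /g; ring.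
split=> //; apply/esym/eqP; rewrite -subr_eq0.
by move/eqP: W0; rewrite mulf_eq0 (negPf gz).
Qed.

End Trace.

(** * Composition with the arc cosine *)

Section Acos.
Context {R : realType}.
Implicit Types (f df : R -> R) (t x e : R).

Lemma acos_lt x e : -1 <= x <= 1 -> 0 < e <= pi -> cos e < x -> acos x < e.
Proof.
move=> x1 /andP[e0 epi] ex; rewrite ltNge; apply/negP => eax.
have : cos (acos x) <= cos e.
  have eI : e \in `[0, pi] by rewrite in_itv/= epi ltW.
  have aI : acos x \in `[0, pi] by rewrite in_itv/= acos_ge0 ?acos_lepi.
  by rewrite leNgt (ltr_cos aI eI) -leNgt.
by rewrite acosK ?in_itv//= leNgt ex.
Qed.

(** At the endpoint [1], where [acos] has no finite slope, continuity comes from monotonicity: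
    [acos] is below [e] as soon as its argument exceeds [cos e]. *)
Lemma acos_comp_continuous_at1 f t : {for t, continuous f} ->
  (forall s, -1 <= f s <= 1) -> f t = 1 -> {for t, continuous (fun s => acos (f s))}.
Proof.
move=> cf f1 ft; apply/cvgrPdist_lt => e e0.
have e'0 : 0 < Num.min e pi by rewrite lt_min e0 pi_gt0.
have e'pi : Num.min e pi <= pi by rewrite ge_min lexx orbT.
have d0 : 0 < 1 - cos (Num.min e pi).
  by rewrite subr_gt0 -(@cos0 R) ltr_cos// in_itv/= ?lexx ?pi_ge0// ltW.
have /cvgrPdist_lt/(_ _ d0) := cf; apply: filterS => s.
rewrite ft acos1 sub0r normrN (ger0_norm (acos_ge0 (f1 s))) => /(le_lt_trans (ler_norm _)).
rewrite ltrD2l ltrN2 => H.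
by apply: lt_le_trans (acos_lt (f1 s) _ H) _; rewrite ?e'0// ge_min lexx.
Qed.

Lemma acos_comp_continuous f t : {for t, continuous f} ->
  (forall s, -1 <= f s <= 1) -> {for t, continuous (fun s => acos (f s))}.
Proof.
move=> cf f1; have := f1 t; rewrite !le_eqVlt => /andP[].
move=> /predU1P[ftN _|ftN /predU1P[ft|ft]].
(* The endpoint [-1] is reflected to [1] by [acos (- x) = pi - acos x]. *)
- have -> : (fun s => acos (f s)) = (fun s => pi - acos (- f s)).
    by apply/funext => s; rewrite -acosN ?opprK// lerNl opprK lerNl andbC.
  apply: (@continuousB R R R (fun=> pi) (fun s => acos (- f s))); first exact: cvg_cst.
  apply: (acos_comp_continuous_at1 (f := fun s => - f s)).
  + exact: continuousN.
  + by move=> s; rewrite lerNl opprK lerNl andbC.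
  + by rewrite -ftN opprK.
- exact: acos_comp_continuous_at1.
- by apply: continuous_comp => //; apply: continuous_acos; rewrite ftN.
Qed.

Lemma subr_sqr_gt0 x : -1 < x < 1 -> 0 < 1 - x ^+ 2.
Proof.
move=> /andP[x1 x2]; rewrite (_ : 1 - x ^+ 2 = (1 - x) * (1 + x)); last by ring.
by apply: mulr_gt0; lra.
Qed.

(** By the mean value theorem, [acos (f s)] would vary by more than [pi] over a unit interval, but
    its values lie in [[0, pi]]. At the two ends [f] may reach [1] or [-1], where only continuity is
    available. *)
Lemma acos_slope f df t : (forall x, is_derive x 1 f (df x)) ->
  (forall x, -1 <= f x <= 1) ->
  (forall x, t < x < t + 1 -> -1 < f x < 1 /\
     pi * Num.sqrt (1 - f x ^+ 2) < `|df x|) -> False.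
Proof.
move=> Df f1 H.
have tt1 : t < t + 1 by rewrite ltrDl.
have [||x xt E] := @mean_value R (fun x => acos (f x))
  (fun x => - (Num.sqrt (1 - f x ^+ 2))^-1 * df x) t (t + 1) tt1.
- move=> x xt; have [fx _] := H x xt.
  exact: (is_derive1_comp (is_derive1_acos fx) (Df x)).
- by move=> x _; apply: acos_comp_continuous => //; exact: is_derive_continuous (Df x).
have [/andP[fN1 f11] Hx] := H x xt.
have s0 : 0 < Num.sqrt (1 - f x ^+ 2).
  by rewrite sqrtr_gt0 subr_sqr_gt0// fN1.
have : pi < `|acos (f (t + 1)) - acos (f t)|.
  rewrite E addrAC subrr add0r mulr1 normrM normrN normfV (gtr0_norm s0).
  by rewrite mulrC ltr_pdivlMr.
apply/negP; rewrite -leNgt ler_norml.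
have := acos_ge0 (f1 t); have := acos_ge0 (f1 (t + 1)).
have := acos_lepi (f1 t); have := acos_lepi (f1 (t + 1)).
by move=> ? ? ? ?; apply/andP; split; lra.
Qed.

End Acos.

(** * Zeros of the lower left entry when all gaps are closed *)

Section Bands.
Context {R : realType} (q11 q12 q22 : R -> R).
Implicit Types (z l m K : R).
Local Notation sol := (dirac_solution q11 q12 q22).

(** The matrix [(b0, e0; e0, c0)] is singular, and [c0] times the form is the integral of the
    squared length of [e0 (a, c) + c0 (b, d)]. As the two columns are independent, this is positive
    unless [c0 = 0]. *)
Lemma trace_integral_degenerate l (a b c d s11 s12 s22 : R -> R) (b0 e0 c0 : R) :
  sol l a c -> sol l b d -> a 0 = 1 -> c 0 = 0 -> b 0 = 0 -> d 0 = 1 ->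
  s11 0 = 0 -> s12 0 = 0 -> s22 0 = 0 ->
  (forall z, 0 <= z -> [/\ is_derive z 1 s11 (a z ^+ 2 + c z ^+ 2),
    is_derive z 1 s12 (a z * b z + c z * d z)
    & is_derive z 1 s22 (b z ^+ 2 + d z ^+ 2)]) ->
  b0 * c0 = e0 ^+ 2 -> b0 * s11 pi + 2 * e0 * s12 pi + c0 * s22 pi = 0 ->
  c0 = 0.
Proof.
move=> ac bd a0 c00 b00 d0 s110 s120 s220 Ds detB E.
apply: contrapT => /eqP c0n.
pose V z := e0 ^+ 2 * s11 z + 2 * e0 * c0 * s12 z + c0 ^+ 2 * s22 z.
have : V 0 < V pi.
  apply: (@derive_gt0_lt _ V
    (fun z => (e0 * a z + c0 * b z) ^+ 2 + (e0 * c z + c0 * d z) ^+ 2)).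
  - exact: pi_gt0.
  - by move=> x /andP[x0 _]; have [D1 D2 D3] := Ds x x0; derive_as ltac:(ring).
  - move=> x /andP[/ltW x0 _].
    rewrite lt_neqAle addr_ge0 ?sqr_ge0// andbT eq_sym.
    rewrite paddr_eq0 ?sqr_ge0// !sqrf_eq0; apply/negP => /andP[/eqP E1 /eqP E2].
    have det : a x * d x - b x * c x = 1.
      by rewrite (dirac_wronskian ac bd)// a0 b00 c00 d0; ring.
    have : c0 * (a x * d x - b x * c x) = 0.
      transitivity (a x * (e0 * c x + c0 * d x) - c x * (e0 * a x + c0 * b x)).
        by ring.
      by rewrite E1 E2; ring.
    by rewrite det mulr1; apply/eqP.
have -> : V pi = c0 * (b0 * s11 pi + 2 * e0 * s12 pi + c0 * s22 pi).
  by rewrite /V -detB; ring.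
by rewrite E mulr0 /V s110 s120 s220 !mulr0 !addr0 ltxx.
Qed.

Lemma continuous_sol l (x y : R -> R) : sol l x y -> continuous x /\ continuous y.
Proof.
move=> xy; split=> z; have [Dx Dy] := xy z.
  exact: is_derive_continuous Dx.
exact: is_derive_continuous Dy.
Qed.

(** Without a zero, half the trace would satisfy the hypotheses of [acos_slope]. *)
Lemma unit_interval_zero K (a b c d : R -> R -> R) (t : R) :
  (forall z, 0 <= z <= pi -> [/\ `|q11 z| <= K, `|q12 z| <= K & `|q22 z| <= K]) ->
  (forall m, [/\ sol m (a m) (c m), sol m (b m) (d m),
    a m 0 = 1 /\ c m 0 = 0 & b m 0 = 0 /\ d m 0 = 1]) ->
  (forall m, `|a m pi + d m pi| <= 2) ->
  ~ (forall z, 0 < z < pi -> q12 z = 0 /\ q11 z = q22 z) ->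
  exists2 m, t < m < t + 1 & c m pi = 0.
Proof.
move=> qK fund D2 nq.
apply: contrapT => nz.
have cn m : t < m < t + 1 -> c m pi != 0.
  by move=> mt; apply/eqP => cm; apply: nz; exists m.
have prim m : exists s : (R -> R) * (R -> R) * (R -> R),
   [/\ s.1.1 0 = 0, s.1.2 0 = 0, s.2 0 = 0 &
    forall z, 0 <= z -> [/\ is_derive z 1 s.1.1 (a m z ^+ 2 + c m z ^+ 2),
    is_derive z 1 s.1.2 (a m z * b m z + c m z * d m z)
    & is_derive z 1 s.2 (b m z ^+ 2 + d m z ^+ 2)]].
  have [ac bd _ _] := fund m.
  have [ca cc] := continuous_sol ac; have [cb cd] := continuous_sol bd.
  have gram (p q r u : R -> R) : continuous p -> continuous q -> continuous r ->
      continuous u -> exists2 s : R -> R, s 0 = 0 &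
      forall z, 0 <= z -> is_derive z 1 s (p z * q z + r z * u z).
    move=> cp cq cr cu.
    apply: (@primitive_exists _ (fun z => p z * q z + r z * u z)) => z.
    apply: (@continuousD R R R (fun z => p z * q z) (fun z => r z * u z)).
      by apply: continuousM; [exact: cp|exact: cq].
    by apply: continuousM; [exact: cr|exact: cu].
  have [s1 s10 Ds1] := gram _ _ _ _ ca ca cc cc.
  have [s2 s20 Ds2] := gram _ _ _ _ ca cb cc cd.
  have [s3 s30 Ds3] := gram _ _ _ _ cb cb cd cd.
  by exists (s1, s2, s3); split => // z z0; split; [exact: Ds1|exact: Ds2|exact: Ds3].
have [s sP] := choice prim.
pose f m := (a m pi + d m pi) / 2.
pose df m := (b m pi * (s m).1.1 pi + (d m pi - a m pi) * (s m).1.2 pi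
  - c m pi * (s m).2 pi) / 2.
have Df m : is_derive m 1 f (df m).
  have [s0 s1 s2 Ds] := sP m.
  have DT := trace_is_derive qK fund s0 s1 s2 Ds.
  rewrite /df /f; derive_as ltac:(ring).
have f1 m : -1 <= f m <= 1.
  by have := D2 m; rewrite /f ler_norml => /andP[? ?]; apply/andP; split; lra.
apply: (acos_slope (t := t) Df f1) => m mt.
have [ac bd [a0 c0] [b0 d0]] := fund m.
have [s0 s1 s2 Ds] := sP m.
have det : a m pi * d m pi - b m pi * c m pi = 1.
  by rewrite (dirac_wronskian ac bd) ?pi_ge0// a0 b0 c0 d0; ring.
have detB : b m pi * (- c m pi) - ((d m pi - a m pi) / 2) ^+ 2 = 1 - f m ^+ 2.
  transitivity (a m pi * d m pi - b m pi * c m pi - f m ^+ 2); last by rewrite det.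
  by rewrite /f; field.
have dfE (u : R) : df m = u / 2 <-> b m pi * (s m).1.1 pi +
   2 * ((d m pi - a m pi) / 2) * (s m).1.2 pi + (- c m pi) * (s m).2 pi = u.
  rewrite /df; split => [H|<-]; last by field.
  have := congr1 (fun v => v * 2) H.
  by rewrite !divfK ?pnatr_eq0// => <-; field.
(* Since [f] is bounded by [1] in modulus on the whole line, a point with [f m ^+ 2 = 1] is an
   extremum and [df m = 0]; then [B] is singular and its entry [- c m pi] has to vanish. *)
have fn1 : f m ^+ 2 != 1.
  apply/eqP => fm1.
  have dfm0 : df m = 0.
    have mI : m \in `]m - 1, m + 1[ by rewrite in_itv/= ltrBlDr !ltrDl ltr01.
    have mm : m - 1 <= m + 1 by rewrite lerD2l -subr_ge0 opprK addr_ge0.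
    have : f m = 1 \/ f m = - 1.
      by move/eqP: fm1; rewrite sqrf_eq1 => /orP[] /eqP; [left|right].
    move=> [fm|fm].
      have Df0 : is_derive m 1 f 0.
        apply: (@derive1_at_max _ f _ _ _ mm _ mI) => x _.
          by have := Df x => -[].
        by rewrite fm; case/andP: (f1 x).
      by rewrite -(@derive_val _ _ _ _ _ _ _ (Df m)) derive_val.
    have Df0 : is_derive m 1 f 0.
      apply: (@derive1_at_min _ f _ _ _ mm _ mI) => x _.
        by have := Df x => -[].
      by rewrite fm; case/andP: (f1 x).
    by rewrite -(@derive_val _ _ _ _ _ _ _ (Df m)) derive_val.
  have := cn m mt; rewrite -oppr_eq0 => /eqP; apply.
  apply: (trace_integral_degenerate ac bd a0 c0 b0 d0 s0 s1 s2 Ds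
    (b0 := b m pi) (e0 := (d m pi - a m pi) / 2)).
    by apply/eqP; rewrite -subr_eq0 detB fm1 subrr.
  by apply/dfE; rewrite dfm0 mul0r.
have flt : -1 < f m < 1.
  have /andP[fm fM] := f1 m; rewrite !lt_neqAle fm fM !andbT.
  by apply/andP; split; apply: contra fn1 => /eqP; [move=> <-|move=> ->]; rewrite ?sqrrN expr1n.
split=> //.
set g := Num.sqrt _.
have g2 : g ^+ 2 = 1 - f m ^+ 2.
  by rewrite sqr_sqrtr// ltW// subr_sqr_gt0.
have gp : 0 < g.
  by rewrite sqrtr_gt0 subr_sqr_gt0.
(* With [b m pi = 0] the left side of [detB] would be minus a square, while it equals
   [g ^+ 2 > 0]. *)
have bn : b m pi != 0.
  apply/eqP => bm; move: detB; rewrite bm mul0r sub0r -g2 => H.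
  by have := exprn_gt0 2 gp; rewrite -H oppr_gt0 ltNge sqr_ge0.
have dfm := (dfE (2 * df m)).1; rewrite mulrAC divff ?mul1r// in dfm.
have {}dfm := dfm erefl.
(* [trace_integral_gt] wants a positive top left entry. For [b m pi < 0] it is applied to [- B],
   which has the same determinant, and it bounds [- df m]. *)
case: (ltgtP (b m pi) 0) bn => // bm _.
- have := trace_integral_gt ac bd a0 c0 b0 d0 s0 s1 s2 Ds
    (b0 := - b m pi) (e0 := - ((d m pi - a m pi) / 2)) (c0 := c m pi) (s := g).
  rewrite oppr_gt0 => /(_ bm gp); rewrite g2 -detB sqrrN mulNr mulrN => /(_ erefl nq) H.
  rewrite (@lt_le_trans _ _ (- df m))//; last by rewrite -normrN ler_norm.
  have {}H : 2 * pi * g < - (2 * df m).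
    rewrite -dfm; apply: (lt_le_trans H).
    by rewrite -subr_ge0 [X in 0 <= X](_ : _ = 0); last ring.
  lra.
- have := trace_integral_gt ac bd a0 c0 b0 d0 s0 s1 s2 Ds bm gp (eq_trans detB (esym g2)) nq.
  rewrite dfm => H.
  rewrite (@lt_le_trans _ _ (df m))//; last exact: ler_norm.
  lra.
Qed.

End Bands.

(** This excludes a minimum at [z], even when [z] is the right end of the interval. *)
Lemma derive_gt0_left {R : realType} (f : R -> R) (w z l : R) :
  is_derive z 1 f l -> 0 < l -> w < z -> exists2 t, w < t < z & f t < f z.
Proof.
move=> [df dfE] l0 wz.
have : (fun h => h^-1 *: ((f \o shift z) (h *: (1 : R)) - f z)) @ 0^' --> l.
  by rewrite -dfE; exact: df.
move=> /cvgrPdist_lt/(_ _ l0)/nbhs_ballP[d /= d0 H].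
pose h := - (Num.min d (z - w) / 2).
have m0 : 0 < Num.min d (z - w) by rewrite lt_min d0 subr_gt0.
have h0 : h < 0 by rewrite oppr_lt0 divr_gt0.
have md : Num.min d (z - w) <= d by rewrite ge_min lexx.
have mz : Num.min d (z - w) <= z - w by rewrite ge_min lexx orbT.
exists (h + z).
  by apply/andP; split; rewrite /h; lra.
have := H h; rewrite /ball /= sub0r normrN => /(_ _ (ltr0_neq0 h0)).
rewrite (ltr0_norm h0) opprK /GRing.scale /= mulr1 => /(_ _).
have hd : Num.min d (z - w) / 2 < d by lra.
move=> /(_ hd); rewrite ltr_distlC => /andP[+ _]; rewrite subrr.
by rewrite nmulr_rgt0 ?invr_lt0// subr_lt0.
Qed.

(** * The Pruefer angle and its dependence on the parameter *)

Section Pruefer.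
Context {R : realType} (q11 q12 q22 : R -> R).
Implicit Types (z l m K : R) (th : R -> R).
Local Notation sol := (dirac_solution q11 q12 q22).

(** The quadratic form of the coefficient matrix at the unit vector of angle [t]. *)
Definition angular_form z (t : R) : R :=
  q11 z * cos t ^+ 2 + 2 * q12 z * (cos t * sin t) + q22 z * sin t ^+ 2.

(** The equation of the polar angle of the solution that starts at [(1, 0)], which is why the angle
    starts at [0]. *)
Definition pruefer_angle l th : Prop :=
  th 0 = 0 /\ forall z, 0 <= z -> is_derive z 1 th (l - angular_form z (th z)).

(** The angle is a primitive of the rotation speed of [(a, c)], so no branch of the arctangent has
    to be chosen. The cross product [v] of [(a, c)] with the unit vector of that angle solves a
    linear equation with zero initial value, hence vanishes. *)
Lemma pruefer_angle_exists l (a b c d : R -> R) :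
  continuous q11 -> continuous q12 -> continuous q22 ->
  sol l a c -> sol l b d -> a 0 = 1 -> c 0 = 0 -> b 0 = 0 -> d 0 = 1 ->
  exists2 th, pruefer_angle l th &
    forall z, 0 <= z -> a z * sin (th z) = c z * cos (th z).
Proof.
move=> cq11 cq12 cq22 ac bd a0 c0 b0 d0.
have [ca cc] := continuous_sol ac.
pose n z := a z ^+ 2 + c z ^+ 2.
have n0 z : 0 < n z.
  rewrite lt_neqAle addr_ge0 ?sqr_ge0// andbT eq_sym.
  rewrite paddr_eq0 ?sqr_ge0// !sqrf_eq0; apply/negP => /andP[/eqP az /eqP cz].
  have := dirac_wronskian ac bd z; rewrite az cz a0 b0 d0 c0.
  by rewrite !(mul0r, mulr0, mulr1, subr0) => /esym/eqP; rewrite oner_eq0.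
have cM (f g : R -> R) : continuous f -> continuous g -> continuous (fun z => f z * g z).
  by move=> cf cg z; apply: continuousM; [exact: cf|exact: cg].
have cD (f g : R -> R) : continuous f -> continuous g -> continuous (fun z => f z + g z).
  by move=> cf cg z; apply: (@continuousD R R R f g); [exact: cf|exact: cg].
have cn : continuous n by apply: (cD (fun z => a z * a z) (fun z => c z * c z)); exact: cM.
have cV (f : R -> R) : continuous f -> continuous (fun z => f z / n z).
  move=> cf; apply: cM => // z; apply: continuousV; last exact: cn.
  by rewrite gt_eqF.
have cst (k : R) : continuous (fun _ : R => k) by move=> z; exact: cvg_cst.
pose g z := l +
  (-1) * ((q11 z * (a z * a z) + (2 * q12 z * (a z * c z) + q22 z * (c z * c z))) / n z).
pose k z := (q12 z * (a z * a z + (-1) * (c z * c z)) + (q22 z + (-1) * q11 z) * (a z * c z)) / n z.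
have cg : continuous g.
  by apply: (cD (fun=> l)) => //; apply: (cM (fun=> -1)) => //; apply: (@cV);
    repeat (first [exact: ca|exact: cc|exact: cq11|exact: cq12|exact: cq22
      |exact: cst|apply: (@cD)|apply: (@cM)]).
have ck : continuous k by apply: (@cV);
    repeat (first [exact: ca|exact: cc|exact: cq11|exact: cq12|exact: cq22
      |exact: cst|apply: (@cD)|apply: (@cM)]).
have [th th0 Dth] := primitive_exists cg.
have [rho rho0 Drho] := primitive_exists ck.
pose v z := a z * sin (th z) + - (c z * cos (th z)).
have v0 z : 0 <= z -> v z = 0.
  move=> z0.
  have : v z * expR (- rho z) = v 0 * expR (- rho 0).
    apply: (@derive_eq0_const _ (fun z => v z * expR (- rho z)) 0 z) => // x /andP[x0 _].
    have D1 := Dth x x0; have D2 := Drho x x0; have [Da Dc] := ac x.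
    rewrite /v; derive_as ltac:(rewrite /g /k /n).
    by field; exact: lt0r_neq0 (n0 x).
  rewrite {2}/v th0 sin0 c0 mulr0 mul0r subrr mul0r => /eqP.
  by rewrite mulf_eq0 [X in _ || X]gt_eqF ?expR_gt0// orbF => /eqP.
have vE z : 0 <= z -> a z * sin (th z) = c z * cos (th z).
  by move=> /v0 /eqP; rewrite subr_eq0 => /eqP.
exists th => //; split=> // z z0; apply: is_derive_eq (Dth z z0) _.
have E := vE z z0.
pose u := a z * cos (th z) + c z * sin (th z).
(* [u] is the signed length of [(a, c)]: as the cross product vanishes, [(a, c)] is [u] times the
   unit vector of angle [th z], which turns [g z] into the required speed. *)
have cs := cos2Dsin2 (th z).
have aE : a z = u * cos (th z).
  transitivity (a z * (cos (th z) ^+ 2 + sin (th z) ^+ 2)); first by rewrite cs mulr1.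
  rewrite /u mulrDr [in a z * sin (th z) ^+ 2]expr2 [a z * (_ * _)]mulrA E; ring.
have cE : c z = u * sin (th z).
  transitivity (c z * (cos (th z) ^+ 2 + sin (th z) ^+ 2)); first by rewrite cs mulr1.
  rewrite /u mulrDr [in c z * cos (th z) ^+ 2]expr2 [c z * (_ * _)]mulrA -E; ring.
have nE : n z = u ^+ 2.
  rewrite /n aE cE -[RHS]mulr1 -[X in _ = _ * X]cs; ring.
have un : u != 0 by move: (n0 z); rewrite nE => /lt0r_neq0; rewrite sqrf_eq0.
by rewrite /g /angular_form nE aE cE; field.
Qed.

Lemma angular_form_lip K z (t s : R) :
  `|q11 z| <= K -> `|q12 z| <= K -> `|q22 z| <= K ->
  `|angular_form z t - angular_form z s| <= 4 * K * `|t - s|.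
Proof.
move=> h1 h2 h3; wlog st : s t / s <= t.
  by move=> W; have [|/ltW] := leP s t; [exact: W|rewrite distrC (distrC t); exact: W].
rewrite (ger0_norm (_ : 0 <= t - s)) ?subr_ge0//.
apply: (@derive_bounded_lip _ (angular_form z) (fun t =>
   2 * q12 z * (cos t ^+ 2 - sin t ^+ 2) + 2 * (q22 z - q11 z) * (cos t * sin t))) => //.
  move=> x _; have Dc := is_derive_cos x; have Ds := is_derive_sin x.
  have -> : angular_form z = fun t => q11 z * (cos t * cos t) +
     2 * q12 z * (cos t * sin t) + q22 z * (sin t * sin t).
    by apply/funext => y; rewrite /angular_form !expr2.
  by derive_as ltac:(ring).
move=> x _; have := quadratic_form_bound (cos x) (sin x) h1 h2 h3.
by rewrite cos2Dsin2 mulr1.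
Qed.

(* The difference [D] of the angles satisfies [|D' - (m - l)| <= 4 K |D|]. *)
Lemma pruefer_angle_lt K l m th th' :
  (forall z, 0 <= z <= pi -> [/\ `|q11 z| <= K, `|q12 z| <= K & `|q22 z| <= K]) ->
  l < m -> pruefer_angle l th -> pruefer_angle m th' ->
  0 < th' pi - th pi <= (m - l) * (pi * expR (4 * K * pi)).
Proof.
move=> qK lm [th0 Dth] [th'0 Dth'].
pose D z := th' z + - th z.
pose dD z := m - l - (angular_form z (th' z) - angular_form z (th z)).
have DD z : 0 <= z -> is_derive z 1 D (dD z).
  by move=> z0; have D1 := Dth z z0; have D2 := Dth' z z0; derive_as ltac:(rewrite /dD; ring).
have D00 : D 0 = 0 by rewrite /D th0 th'0 subrr.
pose M := 4 * K.
have M0 : 0 <= M.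
  have [|+ _ _] := qK 0; first by rewrite lexx pi_ge0.
  by move=> /(le_trans (normr_ge0 _)) K0; rewrite mulr_ge0.
have dDM z : 0 <= z <= pi -> `|dD z - (m - l)| <= M * `|D z|.
  move=> zpi; have [h1 h2 h3] := qK z zpi.
  by rewrite addrAC subrr add0r normrN; exact: angular_form_lip.
have Dexp (s : R) z : 0 <= z -> is_derive z 1 (fun z => D z * expR (s * z))
    ((dD z + s * D z) * expR (s * z)).
  by move=> z0; have D1 := DD z z0; derive_as ltac:(ring).
(* At a negative minimum [x] of [D z * expR (- M * z)], the bound on [dD] gives
   [dD x - M * D x >= m - l > 0], so smaller values occur to the left of [x]. *)
have D_ge0 z : 0 <= z <= pi -> 0 <= D z.
  have ch : {within `[0, pi], continuous (fun z => D z * expR (- M * z))}.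
    apply/continuous_in_subspaceT => x; rewrite inE/= in_itv/= => /andP[x0 _].
    exact: is_derive_continuous (Dexp (- M) x x0).
  have [x + xmin] := EVT_min (pi_ge0 R) ch; rewrite in_itv/= => xpi.
  have Dx : 0 <= D x.
    rewrite leNgt; apply/negP => Dx0.
    have x0 : 0 < x.
      rewrite lt_neqAle (proj1 (andP xpi)) andbT; apply/eqP => x0.
      by move: Dx0; rewrite -x0 D00 ltxx.
    have [|t /andP[t0 tx]] := derive_gt0_left (Dexp (- M) x (ltW x0)) _ x0.
      apply: mulr_gt0; last exact: expR_gt0.
      have := dDM x xpi; rewrite (ltr0_norm Dx0) ler_distl => /andP[H _].
      move: lm H; rewrite -subr_gt0; nra.
    apply/negP; rewrite -leNgt; apply: xmin; rewrite in_itv/= (ltW t0).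
    by rewrite (le_trans (ltW tx))//; case/andP: xpi.
  move=> zpi; have : 0 <= D z * expR (- M * z).
    apply: le_trans (xmin z _); last by rewrite in_itv.
    by rewrite mulr_ge0 ?expR_ge0.
  by rewrite pmulr_lge0 ?expR_gt0.
have in0pi t : 0 < t < (pi : R) -> 0 <= t <= pi by move=> /andP[/ltW -> /ltW ->].
(* Given [D >= 0], the weight [expR (M * z)] yields strict positivity and the weight
   [expR (- M * z)] the Lipschitz bound. *)
apply/andP; split.
  have : D 0 * expR (M * 0) < D pi * expR (M * pi).
    apply: (@derive_gt0_lt _ (fun z => D z * expR (M * z))
      (fun z => (dD z + M * D z) * expR (M * z))); first exact: pi_gt0.
      by move=> x /andP[x0 _]; exact: Dexp.
    move=> x /in0pi xpi; rewrite mulr_gt0 ?expR_gt0//.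
    have := dDM x xpi; rewrite (ger0_norm (D_ge0 x xpi)) ler_distl => /andP[H _].
    move: lm H; rewrite -subr_gt0; lra.
  by rewrite D00 mul0r pmulr_lgt0 ?expR_gt0.
have : (m - l) * 0 - D 0 * expR (- M * 0) <= (m - l) * pi - D pi * expR (- M * pi).
  apply: (@derive_ge0_le _ (fun z => (m - l) * z - D z * expR (- M * z))
    (fun z => (m - l) - (dD z + - M * D z) * expR (- M * z))); first exact: pi_ge0.
    move=> x /andP[x0 _]; have D1 := Dexp (- M) x x0.
    by derive_as ltac:(ring).
  move=> x /in0pi xpi; have := D_ge0 x xpi => Dx0.
  have := dDM x xpi; rewrite (ger0_norm Dx0) ler_distl => /andP[_ H].
  have e1 : expR (- M * x) <= 1.
    by rewrite -expR0 ler_expR mulNr oppr_le0 mulr_ge0//; case/andP: xpi.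
  rewrite subr_ge0; apply: (@le_trans _ _ ((m - l) * expR (- M * x))).
    by rewrite ler_wpM2r ?expR_ge0//; lra.
  by rewrite ler_piMr// subr_ge0 ltW.
rewrite D00 mul0r mulr0 subr0 subr_ge0 mulNr expRN ler_pdivrMr ?expR_gt0//.
by rewrite mulrA.
Qed.

End Pruefer.

(** * Asymptotics of the angle for large parameters *)

Section PrueferAsymptotics.
Context {R : realType} (q11 q12 q22 : R -> R).
Implicit Types (z l m K w : R) (th P : R -> R).

(* On a short interval the coefficients are almost constant, and for constant
   coefficients the integrand is [th' / l] up to [O(1 / l)]. *)
Lemma pruefer_angle_osc K l w th P (x y : R) :
  (forall z, 0 <= z <= pi -> [/\ `|q11 z| <= K, `|q12 z| <= K & `|q22 z| <= K]) ->
  (forall z, 0 <= z -> is_derive z 1 P ((q11 z + q22 z) / 2)) ->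
  pruefer_angle q11 q12 q22 l th -> l != 0 -> 0 <= x -> x <= y -> y <= pi ->
  (forall z, x <= z <= y -> [/\ `|q11 z - q11 x| <= w, `|q12 z - q12 x| <= w
     & `|q22 z - q22 x| <= w]) ->
  `|(th y - l * y + P y) - (th x - l * x + P x)| <=
    (4 * w + 20 * K ^+ 2 / `|l|) * (y - x) + 4 * K / `|l|.
Proof.
move=> qK DP [_ Dth] l0 x0 xy ypi qw.
have xpi : 0 <= x <= pi by rewrite x0 (le_trans xy).
have [k1 k2 k3] := qK x xpi.
have K0 : 0 <= K by apply: le_trans k1.
pose q z := (q11 z - q22 z) / 2.
(* [B] has derivative [F (q x) (q12 x) t / l]. Along [th], whose speed is [l] minus the angular
   form, it cancels the oscillating term with coefficients frozen at [x] and leaves a term of order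
   [1 / l]. *)
pose B (t : R) := (q x * (cos t * sin t) + q12 x * (sin t * sin t)) * l^-1.
pose T z := th z - l * z + P z.
pose A z := T z + B (th z).
(* The trace-free part of the angular form; the trace part is integrated by [P]. *)
pose F (p r t : R) := 2 * r * (cos t * sin t) + p * (cos t ^+ 2 - sin t ^+ 2).
have cs1 (t : R) : `|cos t * sin t| <= 1.
  by rewrite normrM mulr_ile1// ?cos_max ?sin_max.
have FB p r t N : `|p| <= N -> `|r| <= N -> `|F p r t| <= 4 * N.
  move=> pN rN; have N0 : 0 <= N by apply: le_trans pN.
  have H : `|cos t ^+ 2 - sin t ^+ 2| <= 2.
    have := cos2Dsin2 t; have := sqr_ge0 (cos t); have := sqr_ge0 (sin t).
    by rewrite ler_norml => ? ? ?; apply/andP; split; lra.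
  apply: le_trans (ler_normD _ _) _; rewrite !normrM (ger0_norm (ler0n R 2)).
  rewrite (_ : 4 * N = 2 * N * 1 + N * 2); last by ring.
  apply: lerD; last exact: ler_pM.
  by rewrite -normrM; apply: ler_pM => //; rewrite ?mulr_ge0// ler_pM.
have aF z t : angular_form q11 q12 q22 z t = (q11 z + q22 z) / 2 + F (q z) (q12 z) t.
  rewrite /angular_form /F /q.
  rewrite (_ : (q11 z + q22 z) / 2 = (q11 z + q22 z) / 2 * (cos t ^+ 2 + sin t ^+ 2)).
    by field.
  by rewrite cos2Dsin2 mulr1.
pose dA z := - F (q z - q x) (q12 z - q12 x) (th z) -
  F (q x) (q12 x) (th z) * angular_form q11 q12 q22 z (th z) / l.
have DA z : x <= z <= y -> is_derive z 1 A (dA z).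
  move=> /andP[xz _]; have D1 := Dth z (le_trans x0 xz); have D2 := DP z (le_trans x0 xz).
  have E : (q11 z + q22 z) / 2 =
      angular_form q11 q12 q22 z (th z) - F (q z) (q12 z) (th z).
    by rewrite aF addrK.
  rewrite E in D2; rewrite /A /T /B; derive_as ltac:(rewrite /dA).
  by set ang := angular_form _ _ _ _ _; rewrite /F; field.
have dAB z : x < z < y -> `|dA z| <= 4 * w + 20 * K ^+ 2 / `|l|.
  move=> /andP[/ltW xz /ltW zy]; have [w1 w2 w3] : [/\ `|q11 z - q11 x| <= w,
     `|q12 z - q12 x| <= w & `|q22 z - q22 x| <= w] by apply: qw; rewrite xz.
  have [m1 m2 m3] : [/\ `|q11 z| <= K, `|q12 z| <= K & `|q22 z| <= K].
    by apply: qK; rewrite (le_trans x0 xz) (le_trans zy).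
  have half (a b N : R) : `|a| <= N -> `|b| <= N -> `|(a - b) / 2| <= N /\ `|(a + b) / 2| <= N.
    rewrite !ler_norml => /andP[? ?] /andP[? ?].
    by split; apply/andP; split; lra.
  have qw' : `|q z - q x| <= w.
    rewrite (_ : q z - q x = ((q11 z - q11 x) - (q22 z - q22 x)) / 2); last by rewrite /q; ring.
    exact: (half _ _ _ w1 w3).1.
  have angB : `|angular_form q11 q12 q22 z (th z)| <= 5 * K.
    rewrite aF (_ : 5 * K = K + 4 * K); last by ring.
    apply: le_trans (ler_normD _ _) _; apply: lerD; first exact: (half _ _ _ m1 m3).2.
    by apply: FB => //; exact: (half _ _ _ m1 m3).1.
  apply: le_trans (ler_normB _ _) _; rewrite normrN; apply: lerD; first exact: FB.
  rewrite normrM normfV ler_pM2r ?invr_gt0 ?normr_gt0// normrM.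
  rewrite (_ : 20 * K ^+ 2 = 4 * K * (5 * K)); last by ring.
  by apply: ler_pM => //; apply: FB => //; exact: (half _ _ _ k1 k3).1.
have BB t : `|B t| <= 2 * K / `|l|.
  rewrite normrM normfV ler_pM2r ?invr_gt0 ?normr_gt0//.
  apply: le_trans (ler_normD _ _) _; rewrite (_ : 2 * K = K * 1 + K * 1); last by ring.
  have qxK : `|q x| <= K.
    by move: k1 k3; rewrite /q !ler_norml => /andP[? ?] /andP[? ?]; apply/andP; split; lra.
  apply: lerD; rewrite normrM; apply: ler_pM => //.
  by rewrite normrM mulr_ile1// ?sin_max.
rewrite -/(T y) -/(T x) (_ : T y - T x = (A y - A x) + (B (th x) - B (th y))); last first.
  by rewrite /A; ring.
apply: le_trans (ler_normD _ _) _; apply: lerD; first exact: derive_bounded_lip DA dAB.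
rewrite (_ : 4 * K / `|l| = 2 * K / `|l| + 2 * K / `|l|); last by ring.
by apply: le_trans (ler_normB _ _) _; apply: lerD.
Qed.

(** The mesh is fixed first, by uniform continuity; then [|l|] is taken large and the estimates on
    the pieces are added. The limit [- P pi] of [th pi - l * pi] is the same at both infinities. *)
Lemma pruefer_angle_asymptotics K P :
  (forall z, 0 <= z <= pi -> [/\ `|q11 z| <= K, `|q12 z| <= K & `|q22 z| <= K]) ->
  (forall w, 0 < w -> exists2 d : R, 0 < d & forall x y : R, 0 <= x -> x <= y -> y <= pi ->
    y - x < d -> [/\ `|q11 y - q11 x| <= w, `|q12 y - q12 x| <= w
     & `|q22 y - q22 x| <= w]) ->
  P 0 = 0 -> (forall z, 0 <= z -> is_derive z 1 P ((q11 z + q22 z) / 2)) ->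
  forall e, 0 < e -> exists L, forall l, L <= `|l| ->
    forall th, pruefer_angle q11 q12 q22 l th -> `|th pi - l * pi + P pi| <= e.
Proof.
move=> qK uc P0 DP e e0.
have pi0 := pi_gt0 R.
have K0 : 0 <= K.
  have [|+ _ _] := qK 0; first by rewrite lexx pi_ge0.
  exact: le_trans.
(* With this oscillation [w], the pieces contribute [4 * w * pi = e / 2] in total. *)
have w0 : 0 < e / (8 * pi) by rewrite divr_gt0// mulr_gt0.
have [d d0 dP] := uc _ w0.
pose N := Num.bound (pi / d).
have Nd : pi / d < N%:R by apply: archi_boundP; rewrite divr_ge0// ltW.
have N0 : 0 < N%:R :> R by apply: le_lt_trans Nd; rewrite divr_ge0// ltW.
pose C := 20 * K ^+ 2 * pi + 4 * K * N%:R.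
have C0 : 0 <= C by rewrite addr_ge0// ?mulr_ge0 ?sqr_ge0// ltW.
(* The term [2 * C / e] makes [C / |l| <= e / 2], and adding [1] keeps [l] nonzero. *)
exists (2 * C / e + 1) => l Ll th lth.
have l0 : 0 < `|l| by apply: lt_le_trans Ll; rewrite ltr_wpDl// divr_ge0 ?mulr_ge0// ltW.
have ln0 : l != 0 by rewrite -normr_gt0.
pose h : R := pi / N%:R.
have h0 : 0 <= h by rewrite divr_ge0// ltW.
have hd : h < d by rewrite ltr_pdivrMr// mulrC -ltr_pdivrMr.
pose T z := th z - l * z + P z.
pose M := (4 * (e / (8 * pi)) + 20 * K ^+ 2 / `|l|) * h + 4 * K / `|l|.
have ind (i : nat) : (i <= N)%N -> `|T (i%:R * h)| <= i%:R * M.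
  elim: i => [_|i IHi iN].
    have [th0 _] := lth.
    by rewrite !mul0r /T th0 P0 mulr0 subrr addr0 normr0.
  have -> : T (i.+1%:R * h) = T (i%:R * h) + (T (i.+1%:R * h) - T (i%:R * h)) by ring.
  apply: le_trans (ler_normD _ _) _; rewrite -[in leRHS]natr1 mulrDl mul1r.
  apply: lerD; first by apply: IHi; exact: ltnW.
  have E : i.+1%:R * h - i%:R * h = h by rewrite -natr1; ring.
  rewrite /M -[X in _ * X + _]E; apply: (pruefer_angle_osc qK DP lth ln0).
  - by rewrite mulr_ge0.
  - by rewrite -subr_ge0 E.
  - by rewrite /h mulrCA ler_piMr ?pi_ge0// ler_pdivrMr// mul1r ler_nat.
  - move=> z /andP[iz zi]; apply: dP => //.
    + by rewrite mulr_ge0.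
    + apply: (le_trans zi).
      by rewrite /h mulrCA ler_piMr ?pi_ge0// ler_pdivrMr// mul1r ler_nat.
    + by apply: le_lt_trans hd; move: zi E; lra.
have Nh : N%:R * h = pi by rewrite /h mulrC divfK// gt_eqF.
have := ind N (leqnn N); rewrite Nh => /le_trans; apply.
have -> : N%:R * M = e / 2 + C / `|l|.
  rewrite /M mulrDr mulrCA Nh /C; move: (pi : R) pi0 => p p0; field.
  by rewrite !gt_eqF.
rewrite [leRHS](splitr e) lerD2l ler_pdivrMr//.
have : 2 * C / e <= `|l| by apply: le_trans Ll; rewrite lerDl.
by rewrite ler_pdivrMr// => ?; lra.
Qed.

End PrueferAsymptotics.

(** * Spacing of the zeros of the sine of the phase *)

Section Phase.
Context {R : realType}.
Implicit Types (phi : R -> R) (x y t l m e C p : R).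

Lemma sin_eq0_gap x y : sin x = 0 -> x < y < x + pi -> sin y != 0.
Proof.
move=> sx /andP[xy yx]; rewrite (_ : y = x + (y - x)); last by ring.
rewrite sinD sx mul0r add0r mulf_neq0//.
  apply/eqP => cx; have := cos2Dsin2 x; rewrite sx cx expr0n add0r.
  by move=> /esym/eqP; rewrite oner_eq0.
by rewrite gt_eqF// sin_gt0_pi// subr_gt0 xy ltrBlDl.
Qed.

Lemma sin_natmul_pi (n : nat) : sin (n%:R * pi) = 0 :> R.
Proof.
elim: n => [|n IHn]; first by rewrite mul0r sin0.
by rewrite -natr1 mulrDl mul1r sinDpi IHn oppr0.
Qed.

Lemma lipschitz_continuous phi C :
  (forall l m, l < m -> 0 < phi m - phi l <= (m - l) * C) -> continuous phi.
Proof.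
move=> H t; apply/cvgrPdist_le => e e0.
have C0 : 0 < C.
  have /andP[a b] := H 0 1 ltr01; move: (lt_le_trans a b).
  by rewrite subr0 mul1r.
have lip s : `|phi t - phi s| <= `|t - s| * C.
  case: (ltgtP t s) => [ts|st|->]; last by rewrite !subrr normr0 mul0r.
    have /andP[a b] := H _ _ ts.
    by rewrite distrC (gtr0_norm a) distrC gtr0_norm ?subr_gt0.
  have /andP[a b] := H _ _ st.
  by rewrite (gtr0_norm a) gtr0_norm ?subr_gt0.
near=> s.
apply: (le_trans (lip s)); rewrite -ler_pdivlMr//.
near: s; apply: cvgr_dist_le; last exact: divr_gt0.
exact: cvg_id.
Unshelve. all: by end_near. Qed.

(* The preimages [l_n] of [n pi] satisfy [l_(n+1) < l_n + 1], while [l_n - n]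
   has the same limit at both infinities. *)
Lemma phase_contradiction phi C p :
  (forall l m, l < m -> 0 < phi m - phi l <= (m - l) * C) ->
  (forall e, 0 < e -> exists L, forall l, L <= `|l| ->
     `|phi l - l * pi + p| <= e) ->
  (forall t, exists2 m, t < m < t + 1 & sin (phi m) = 0) -> False.
Proof.
move=> incr asym zero.
have pi0 := pi_gt0 R.
have mono l m : l < m -> phi l < phi m.
  by move=> lm; have /andP[] := incr _ _ lm; rewrite subr_gt0.
have mono_inv l m : phi l < phi m -> l < m.
  by move=> H; rewrite ltNge; apply/negP; rewrite le_eqVlt => /predU1P[E|/mono];
    [rewrite E ltxx in H|rewrite ltNge (ltW H)].
have surj x : exists l, phi l = x.
  have [L HL] := asym 1 ltr01.
  (* So large that the asymptotics with error [1] put [x] between [phi (- b)] and [phi b]. *)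
  pose b := Num.max `|L| ((`|x| + `|p| + 1) / pi).
  have b0 : 0 <= b by rewrite le_max normr_ge0.
  have Lb : L <= `|b| by rewrite ger0_norm// le_max ler_norm.
  have bx : `|x| + `|p| + 1 <= b * pi by rewrite -ler_pdivrMr// le_max lexx orbT.
  have H1 := HL b Lb; have H2 := HL (- b); rewrite normrN in H2.
  have {}H2 := H2 Lb.
  move: H1 H2; rewrite !ler_norml => /andP[h1 h2] /andP[h3 h4].
  have := ler_norm x; have := ler_norm (- x); have := ler_norm p; have := ler_norm (- p).
  rewrite !normrN => p1 p2 x1 x2.
  have bb : - b <= b by rewrite -subr_ge0 opprK addr_ge0.
  have [||l _ lx] := @IVT R phi (- b) b x bb.
  - exact/continuous_subspaceT/(lipschitz_continuous incr).
  - rewrite ge_min le_max; apply/andP; split; apply/orP; [left|right]; lra.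
  by exists l.
have [Lam LamE] := choice surj.
(* If [Lam (x + pi)] were at least [Lam x + 1], the root supplied by [zero] would have its phase in
   []x, x + pi[], where [sin] has no zero. *)
have step x : sin x = 0 -> Lam (x + pi) < Lam x + 1.
  move=> sx; rewrite ltNge; apply/negP => H.
  have [m /andP[xm mx] sm] := zero (Lam x).
  have : sin (phi m) != 0.
    apply: (sin_eq0_gap sx); rewrite -{1}(LamE x) mono//=.
    by rewrite -(LamE (x + pi)) mono// (lt_le_trans mx).
  by rewrite sm eqxx.
have up (n : nat) : Lam (pi + n%:R * pi) <= Lam pi + n%:R.
  elim: n => [|n IHn]; first by rewrite mul0r !addr0.
  rewrite (_ : pi + n.+1%:R * pi = pi + n%:R * pi + pi); last by rewrite -natr1; ring.
  rewrite -[in leRHS]natr1 [leRHS]addrA.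
  have s0 : sin (pi + n%:R * pi) = 0 :> R.
    by rewrite addrC sinDpi sin_natmul_pi oppr0.
  by apply: (le_trans (ltW (step _ s0))); rewrite lerD2r.
have down (n : nat) : Lam 0 - n%:R <= Lam (- (n%:R * pi)).
  elim: n => [|n IHn]; first by rewrite mulr0n !(mul0r, oppr0, addr0).
  have /step : sin (- (n.+1%:R * pi)) = 0 :> R by rewrite sinN sin_natmul_pi oppr0.
  rewrite (_ : - (n.+1%:R * pi) + pi = - (n%:R * pi)); last by rewrite -natr1; ring.
  have -> : Lam 0 - n.+1%:R = Lam 0 - n%:R - 1 by rewrite -natr1; ring.
  by move: IHn; lra.
(* The strict step from [0] to [pi] creates a slack that the weak inequalities [up] and [down]
   preserve. *)
have d0 : 0 < Lam 0 + 1 - Lam pi.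
  by rewrite subr_gt0 -{1}[pi]add0r step// sin0.
(* With a third of the slack as tolerance, the errors at the two infinities add up to less than the
   slack. *)
have e0 : 0 < (Lam 0 + 1 - Lam pi) * pi / 3 by rewrite divr_gt0 ?mulr_gt0.
have [L HL] := asym _ e0.
(* This [n] carries the phases [pi + n pi] and [- n pi] beyond those of [|L|] and [- |L|], so by
   monotonicity both parameters lie in the asymptotic range. *)
pose n := (Num.bound (Num.max (`|phi `|L| | / pi) (`|phi (- `|L|)| / pi))).
have nb : Num.max (`|phi `|L| | / pi) (`|phi (- `|L|)| / pi) < n%:R.
  have := archi_boundP (x := Num.max (`|phi `|L| | / pi) (`|phi (- `|L|)| / pi)).
  by apply; rewrite le_max divr_ge0// ltW.
move: nb; rewrite gt_max !ltr_pdivrMr// => /andP[n1 n2].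
have /HL H1 : L <= `|Lam (pi + n%:R * pi)|.
  rewrite (le_trans (ler_norm _))// (le_trans _ (ler_norm _))// ltW// mono_inv// LamE.
  by rewrite (le_lt_trans (ler_norm _))// (lt_le_trans n1)// lerDr ltW.
have /HL H2 : L <= `|Lam (- (n%:R * pi))|.
  have H : Lam (- (n%:R * pi)) < - `|L|.
    by apply: mono_inv; rewrite LamE ltrNl (le_lt_trans (ler_norm _))// normrN.
  rewrite -normrN; apply: (le_trans (ler_norm L)).
  by apply: le_trans (ler_norm _); rewrite lerNr ltW.
move: H1 H2; rewrite !LamE !ler_norml => /andP[h1 h2] /andP[h3 h4].
have u1 : Lam (pi + n%:R * pi) * pi <= (Lam pi + n%:R) * pi by rewrite ler_pM2r.
have u2 : (Lam 0 - n%:R) * pi <= Lam (- (n%:R * pi)) * pi by rewrite ler_pM2r.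
move: e0 h1 h2 h3 h4 u1 u2.
set X := Lam (pi + _) * pi; set Y := Lam (- _) * pi.
nra.
Qed.

End Phase.

(** * Consequences of absolute continuity and periodicity *)

Section Coefficients.
Context {R : realType}.
Implicit Types (f g : R -> R) (x y z e : R).

Lemma abs_continuous_on_uniform f (a b : R) e : abs_continuous_on f a b -> 0 < e ->
  exists2 d : R, 0 < d & forall x y, a <= x -> x <= y -> y <= b -> y - x < d ->
    `|f y - f x| < e.
Proof.
move=> fac e0; have [d d0 H] := fac e e0; exists d => // x y ax xy yb yxd.
have := H 1%N (fun=> x) (fun=> y); rewrite !big_ord_recl !big_ord0 !addr0; apply => //.
by move=> i j _ _ _; rewrite !ord1.
Qed.

Lemma abs_continuous_continuous f : abs_continuous f -> continuous f.
Proof.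
move=> fac z; apply/cvgrPdist_lt => e e0.
have [|d d0 H] := @abs_continuous_on_uniform f (z - 1) (z + 1) e _ e0.
  by apply: fac; lra.
near=> s.
have s1 : `|z - s| < 1.
  by near: s; apply: cvgr_dist_lt => //; exact: cvg_id.
have sd : `|z - s| < d.
  by near: s; apply: cvgr_dist_lt => //; exact: cvg_id.
move/ltr_normlP: s1 => [s1 s2]; move/ltr_normlP: sd => [s3 s4].
have [zs|/ltW sz] := leP z s; first by rewrite distrC; apply: H; lra.
by apply: H; lra.
Unshelve. all: by end_near. Qed.

Lemma continuous_bounded_pi f : continuous f ->
  exists K : R, forall z, 0 <= z <= pi -> `|f z| <= K.
Proof.
move=> cf; have cn : {within `[0, (pi : R)], continuous (fun z => `|f z|)}.
  by apply: continuous_subspaceT => z; apply: cvg_norm; exact: cf.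
have [c _ cmax] := EVT_max (pi_ge0 R) cn.
by exists `|f c| => z zpi; apply: cmax; rewrite in_itv.
Qed.

(** Continuity from the right gives the value at [0], induction on the number of periods gives
    [z >= 0], and a shift by [n] periods brings any other [z] there. *)
Lemma periodic_eq0 f : continuous f -> periodic f pi ->
  (forall z, 0 < z < pi -> f z = 0) -> forall z, f z = 0.
Proof.
move=> cf fp f0.
have pi0 := pi_gt0 R.
have f00 : f 0 = 0.
  apply: contrapT => /eqP; rewrite -normr_gt0 => n0.
  have /cvgrPdist_lt/(_ _ n0) H : f x @[x --> (0 : R)^'+] --> f 0.
    by apply: cvg_at_right_filter; exact: cf.
  near (0 : R)^'+ => s.
  have : `|f 0 - f s| < `|f 0| by near: s.
  have sI : 0 < s < pi.
    by apply/andP; split; near: s; [exact: nbhs_right_gt|exact: nbhs_right_lt].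
  by rewrite (f0 s sI) subr0 ltxx.
have pos (n : nat) z : 0 <= z < n%:R * pi -> f z = 0.
  elim: n z => [|n IHn] z /andP[z0 zn].
    by move: zn; rewrite mul0r ltNge z0.
  have [zpi|zpi] := ltP z pi.
    move: z0; rewrite le_eqVlt => /predU1P[<- //|z0].
    by apply: f0; rewrite z0.
  rewrite -[z](subrK pi) fp; apply: IHn; rewrite subr_ge0 zpi/=.
  by move: zn; rewrite -natr1 mulrDl mul1r ltrBlDr.
move=> z; pose n := Num.bound (`|z| / pi).
have zn : `|z| < n%:R * pi.
  by rewrite -ltr_pdivrMr// archi_boundP// divr_ge0// ltW.
rewrite -(periodicn fp n); apply: (pos (n + n)%N).
move: zn; rewrite ltr_norml natrD mulrDl -mulr_natl => /andP[? ?].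
by apply/andP; split; lra.
Unshelve. all: by end_near. Qed.

End Coefficients.

(** * Back to the matrix equation *)

Lemma fundamental_solution_column {R : realType} (Q : R -> 'M[R]_2)
    (Y : R -> R -> 'M[R]_2) (l : R) (j : 'I_2) :
  (forall z, (Q z)^T = Q z) -> fundamental_solution Q Y ->
  dirac_solution (fun z => Q z 0 0) (fun z => Q z 0 1) (fun z => Q z 1 1) l
    (fun z => Y z l 0 j) (fun z => Y z l 1 j).
Proof.
move=> Qsym Ysol z; have [_ /(_ z)[DY eq]] := Ysol l.
have D i : is_derive z 1 (fun z => Y z l i j) (derive1 (Y ^~ l) z i j).
  have DYi := (derivable_mxP _ _ _).1 DY i j.
  by split=> //; rewrite derive1E derive_mx// mxE.
have Q10 : Q z 1 0 = Q z 0 1 by rewrite -{1}[Q z]Qsym mxE.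
have e0 := congr1 (fun M : 'M[R]_2 => M 0 j) eq.
have e1 := congr1 (fun M : 'M[R]_2 => M 1 j) eq.
rewrite !mxE !big_ord_recl !big_ord0 !mxE /= in e0 e1.
have l0 : lift ord0 ord0 = 1 :> 'I_2 by exact: val_inj.
rewrite !l0 ?Q10 in e0 e1.
(* [J] exchanges the rows, so the derivative of the first component comes from row [1] and that of
   the second from row [0]. *)
split.
  apply: is_derive_eq (D 0) _; move: e1; lra.
apply: is_derive_eq (D 1) _; move: e0; lra.
Qed.

Lemma closed_gaps_scalar {R : realType} (q11 q12 q22 : R -> R)
    (a b c d : R -> R -> R) :
  continuous q11 -> continuous q12 -> continuous q22 ->
  (forall w : R, 0 < w -> exists2 e : R, 0 < e & forall x y : R,
    0 <= x -> x <= y -> y <= pi -> y - x < e ->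
    [/\ `|q11 y - q11 x| <= w, `|q12 y - q12 x| <= w & `|q22 y - q22 x| <= w]) ->
  (forall m, [/\ dirac_solution q11 q12 q22 m (a m) (c m),
    dirac_solution q11 q12 q22 m (b m) (d m),
    a m 0 = 1 /\ c m 0 = 0 & b m 0 = 0 /\ d m 0 = 1]) ->
  (forall m, `|a m pi + d m pi| <= 2) ->
  forall z, 0 < z < pi -> q12 z = 0 /\ q11 z = q22 z.
Proof.
move=> c11 c12 c22 uc fund D2; apply: contrapT => nq.
have [K1 qK1] := continuous_bounded_pi c11.
have [K2 qK2] := continuous_bounded_pi c12.
have [K3 qK3] := continuous_bounded_pi c22.
pose K := Num.max K1 (Num.max K2 K3).
have qK z : 0 <= z <= pi -> [/\ `|q11 z| <= K, `|q12 z| <= K & `|q22 z| <= K].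
  by move=> zpi; rewrite /K !le_max qK1// qK2// qK3// !orbT.
have cP : continuous (fun z => (q11 z + q22 z) / 2).
  move=> z; apply: (@continuousM _ _ (fun z => q11 z + q22 z) (fun=> 2^-1)).
    by apply: (@continuousD R R R q11 q22); [exact: c11|exact: c22].
  exact: cvg_cst.
have [P P0 DP] := primitive_exists cP.
have angle m : exists th, pruefer_angle q11 q12 q22 m th /\
    forall z, 0 <= z -> a m z * sin (th z) = c m z * cos (th z).
  have [ac bd [a0 c0] [b0 d0]] := fund m.
  by have [th ? ?] := pruefer_angle_exists c11 c12 c22 ac bd a0 c0 b0 d0; exists th.
have [th thP] := choice angle.
apply: (@phase_contradiction _ (fun m => th m pi) (pi * expR (4 * K * pi)) (P pi)).
- by move=> l m lm; exact: pruefer_angle_lt qK lm (thP l).1 (thP m).1.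
- move=> e e0; have [L HL] := pruefer_angle_asymptotics qK uc P0 DP e0.
  by exists L => l /HL; apply; exact: (thP l).1.
- move=> t; have [m mt cm] := unit_interval_zero t qK fund D2 nq; exists m => //.
  have [ac bd [a0 c0] [b0 d0]] := fund m.
  (* Where [c] vanishes, the determinant gives a nonzero [a], so [a sin = c cos] makes the sine of
     the angle vanish. *)
  have := dirac_wronskian ac bd pi; rewrite cm a0 b0 c0 d0 !(mulr0, subr0, mulr1) => ad.
  have := (thP m).2 pi (pi_ge0 R); rewrite cm mul0r => /eqP.
  rewrite mulf_eq0 => /orP[/eqP am|/eqP //].
  by move/eqP: ad; rewrite am mul0r eq_sym oner_eq0.
Qed.

(** For a scalar potential the system is a rotation and [x ^+ 2 + y ^+ 2] is conserved. Each
    diagonal entry at [pi] is then at most [1] in modulus. *)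
Lemma scalar_dirac_solution_bound {R : realType} (q11 q12 q22 : R -> R) (l : R)
    (x y : R -> R) :
  (forall z, q12 z = 0) -> (forall z, q11 z = q22 z) ->
  dirac_solution q11 q12 q22 l x y -> x 0 ^+ 2 + y 0 ^+ 2 = 1 ->
  `|x pi| <= 1 /\ `|y pi| <= 1.
Proof.
move=> q120 q1122 xy xy0.
have E : x pi * x pi + y pi * y pi = x 0 * x 0 + y 0 * y 0.
  apply: (@derive_eq0_const _ (fun z => x z * x z + y z * y z) 0 pi).
    exact: pi_ge0.
  move=> z _; have [Dx Dy] := xy z.
  by derive_as ltac:(rewrite q120 q1122; ring).
have {}E : x pi ^+ 2 + y pi ^+ 2 = 1 by rewrite !expr2 E -!expr2.
have := sqr_ge0 (x pi); have := sqr_ge0 (y pi) => y2 x2.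
by split; rewrite -(@expr_le1 _ 2)// real_normK ?num_real//; lra.
Qed.

(** The component of a point of the set contains that point, so the components can all be empty only
    if there are none. *)
Lemma all_instability_intervals_vanishP {R : realType} (Y : R -> R -> 'M[R]_2) :
  all_instability_intervals_vanish Y <->
  forall l, `|Y pi l 0 0 + Y pi l 1 1| <= 2.
Proof.
have trE l : discriminant Y l = Y pi l 0 0 + Y pi l 1 1.
  rewrite /discriminant /mxtrace !big_ord_recl big_ord0 addr0.
  by congr (_ + Y pi l _ _); exact: val_inj.
split=> [H l|H I [l]]; last first.
  by rewrite /instability_set /= trE ltNge H.
rewrite leNgt; apply/negP => Dl.
have Sl : instability_set Y l by rewrite /instability_set /= trE.
have E : connected_component (instability_set Y) l = set0 by apply: H; exists l.
by have := connected_component_refl Sl; rewrite E.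
Qed.

Unset Implicit Arguments.

Theorem theorem6p4 (R : realType) (Q : R -> 'M[R]_2) (Y : R -> R -> 'M[R]_2)
    (Qsym : forall z : R, (Q z)^T = Q z)
    (Qac : forall i j : 'I_2, abs_continuous (fun z => Q z i j))
    (Qper : forall i j : 'I_2, periodic (fun z => Q z i j) pi)
    (Ysol : fundamental_solution Q Y) :
  all_instability_intervals_vanish Y <->
  exists p : R -> R,
    [/\ abs_continuous p, periodic p pi & forall z : R, Q z = (p z)%:M].
Proof.
have Y0 l i j : Y 0 l i j = (i == j)%:R.
  by have [-> _] := Ysol l; rewrite mxE.
rewrite all_instability_intervals_vanishP; split=> [D2|[p [_ _ Qp]] l]; last first.
  have Q12 z : Q z 0 1 = 0 by rewrite Qp mxE.
  have Q1122 z : Q z 0 0 = Q z 1 1 by rewrite Qp !mxE.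
  have [|x0 _] := scalar_dirac_solution_bound Q12 Q1122
    (fundamental_solution_column l 0 Qsym Ysol).
    by rewrite !Y0 /= expr1n expr0n addr0.
  have [|_ x1] := scalar_dirac_solution_bound Q12 Q1122
    (fundamental_solution_column l 1 Qsym Ysol).
    by rewrite !Y0 /= expr1n expr0n add0r.
  by apply: le_trans (ler_normD _ _) _; lra.
have cQ i j : continuous (fun z => Q z i j) by exact: abs_continuous_continuous.
have QI : forall z, 0 < z < pi -> Q z 0 1 = 0 /\ Q z 0 0 = Q z 1 1.
  apply: (@closed_gaps_scalar R _ _ _ (fun l z => Y z l 0 0) (fun l z => Y z l 0 1)
    (fun l z => Y z l 1 0) (fun l z => Y z l 1 1) (cQ 0 0) (cQ 0 1) (cQ 1 1)) => //.
    move=> w w0.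
    have [d1 d10 H1] := abs_continuous_on_uniform (Qac 0 0 _ _ (pi_ge0 R)) w0.
    have [d2 d20 H2] := abs_continuous_on_uniform (Qac 0 1 _ _ (pi_ge0 R)) w0.
    have [d3 d30 H3] := abs_continuous_on_uniform (Qac 1 1 _ _ (pi_ge0 R)) w0.
    exists (Num.min d1 (Num.min d2 d3)); first by rewrite !lt_min d10 d20.
    move=> x y x0 xy ypi; rewrite !lt_min => /and3P[e1 e2 e3].
    by split; apply/ltW; [exact: H1|exact: H2|exact: H3].
  move=> m; rewrite !Y0; split => //; exact: fundamental_solution_column.
(* [QI] only covers []0, pi[]; continuity and periodicity extend it to the whole line. *)
exists (fun z => Q z 0 0); split; [exact: Qac|exact: Qper|move=> z].
have Q12 : Q z 0 1 = 0.
  by apply: (periodic_eq0 (cQ 0 1) (Qper 0 1)) => x /QI[].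
have Q1122 : Q z 0 0 - Q z 1 1 = 0.
  apply: (@periodic_eq0 _ (fun z => Q z 0 0 - Q z 1 1)).
  - by move=> x; apply: (@continuousB R R R (fun z => Q z 0 0)); exact: cQ.
  - by move=> x; rewrite (Qper 0 0 x) (Qper 1 1 x).
  - by move=> x /QI[_ ->]; rewrite subrr.
have Q21 : Q z 1 0 = 0 by rewrite -Q12 -{1}[Q z]Qsym mxE.
apply/matrixP => i j; rewrite mxE.
have ord2 (k : 'I_2) : k = 0 \/ k = 1.
  by case: k => [[|[|//]] k2]; [left|right]; exact: val_inj.
have [-> | ->] := ord2 i; have [-> | ->] := ord2 j; rewrite ?Q12 ?Q21//.
by apply/esym/eqP; rewrite -subr_eq0 Q1122.
Qed.
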